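(* Let $n\ge 1$. Every partial order $\preceq$ on $\mathfrak S_n$ such that $(\mathfrak S_n,\preceq)$ is a distributive lattice and such that $v\le_R w\Rightarrow v\preceq w\Rightarrow v\le w$ for all $v,w\in\mathfrak S_n$ (where $\le_R$ is the right weak order and $\le$ the Bruhat order) is equal to $\le_T$ for some binary tree $T\in \mathrm T_{n-1}$.
   Context: Permutations $w\in\mathfrak S_n$ are written as words $w=w_1\cdots w_n$. The inversion set of $w$ is the set of pairs of values $(i,j)$, $1\le i<j\le n$, such that $j$ appears before $i$ in $w$. The right weak order is: $v\le_R w$ iff the inversion set of $v$ is contained in that of $w$. The Bruhat order $\le$ is the usual one. The poset $\mathcal P_n$ is the set of pairs of integers $(i,j)$ with $1\le i<j\le n$, ordered by $(i_1,j_1)\le(i_2,j_2)$ iff $i_2\le i_1$ and $j_1\le j_2$. For $\sigma=\sigma_1\cdots\sigma_{n-1}\in\mathfrak S_{n-1}$ and $1\le k\le n-1$ let $$\mathcal R_{\sigma,k}=\{x\in\mathcal P_n:\ (k,k+1)\le x\ \text{and}\ (\sigma_\ell,\sigma_\ell+1)\not\le x\ \text{for all}\ \ell<\sigma^{-1}(k)\}.$$ These sets partition $\mathcal P_n$; each gets the order induced from $\mathcal P_n$, and $\mathcal R_\sigma$ is the disjoint union of the posets $\mathcal R_{\sigma,k}$. $\mathrm T_{n-1}$ is the set of binary trees with internal nodes labelled $1,\dots,n-1$ in in-order. The binary search tree of $\sigma$ has root $\sigma_1$, and its left (resp. right) subtree is the binary search tree of the subword of $\sigma$ of values smaller (resp.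 greater) than $\sigma_1$. Every $T\in \mathrm T_{n-1}$ is the binary search tree of some $\sigma\in\mathfrak S_{n-1}$, and $\mathcal R_\sigma$, $\mathcal R_{\sigma,k}$ depend only on $T$; they are written $\mathcal R_T$, $\mathcal R_{T,k}$. Let $(i_{T,k},j_{T,k})$ be the maximum of $\mathcal R_{T,k}$. For $w\in\mathfrak S_n$ let $w^{L,k}$ (resp. $w^{R,k}$) be the subword of $w$ of values in $[i_{T,k},k]$ (resp. in $[k+1,j_{T,k}]$). Then $I_T(w)\subset\mathcal R_T$ is the set such that, for all $1\le k\le n-1$, $i_{T,k}\le i\le k$, $k+1\le j\le j_{T,k}$: $(i,j)\in I_T(w)$ iff the value $w^{L,k}_{i-i_{T,k}+1}$ appears after the value $w^{R,k}_{j-k}$ in $w$. The partial order $\le_T$ on $\mathfrak S_n$ is $v\le_T w$ iff $I_T(v)\subset I_T(w)$. *)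

(* Defs.v *)
From HB Require Import structures.
From mathcomp Require Import all_boot all_order all_fingroup.

Set Implicit Arguments.
Unset Strict Implicit.
Unset Printing Implicit Defensive.

(* A permutation w : 'S_n acts on 'I_n = {0, ..., n-1}; its word
   w_1 ... w_n has letters in {1, ..., n}. *)
Definition word n (w : 'S_n) : seq nat := [seq (w i).+1 | i <- enum 'I_n].

Definition before (s : seq nat) (a b : nat) : bool := index a s < index b s.

(* The set of pairs (i, j) with 1 <= i < j <= n, as a duplicate-free list. *)
Definition P_ n : seq (nat * nat) :=
  [seq x <- [seq (i, j) | i <- iota 1 n, j <- iota 1 n] | x.1 < x.2].

Definition P_le : rel (nat * nat) := fun x y => (y.1 <= x.1) && (x.2 <= y.2).

Definition inversions n (w : 'S_n) : seq (nat * nat) :=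
  [seq x <- P_ n | before (word w) x.2 x.1].

Definition weak_le n : rel 'S_n := fun v w => all [in inversions w] (inversions v).

Definition bruhat_step n : rel 'S_n := fun v w =>
  [exists a, exists b, w == (v * tperm a b)%g] && (size (inversions v) < size (inversions w)).

Definition bruhat_le n : rel 'S_n := connect (@bruhat_step n).

(* T carries a distrLatticeType structure whose order relation is le. *)
Definition distributive_lattice (T : Type) (le : rel T) : Prop :=
  exists (d : Order.disp_t) (L : Order.DistrLattice d T),
    forall x y, le x y = @Order.le d (Order.DistrLattice.Pack L) x y.

Inductive tree := Leaf | Node of tree & nat & tree.

Fixpoint inorder (t : tree) : seq nat :=
  if t is Node l x r then inorder l ++ x :: inorder r else [::].

Fixpoint preorder (t : tree) : seq nat :=
  if t is Node l x r then x :: preorder l ++ preorder r else [::].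

Definition T_ m : pred tree := [pred t | inorder t == iota 1 m].

Inductive is_bst : seq nat -> tree -> Prop :=
| bst_nil : is_bst [::] Leaf
| bst_cons x s l r :
    is_bst [seq y <- s | y < x] l -> is_bst [seq y <- s | x < y] r ->
    is_bst (x :: s) (Node l x r).

(* R_{s,k} for the word s of a permutation in S_{n-1}. *)
Definition Rword n (s : seq nat) (k : nat) : seq (nat * nat) :=
  [seq x <- P_ n | P_le (k, k.+1) x
                   & all (fun l => ~~ P_le (l, l.+1) x) (take (index k s) s)].

(* R_{t,k} := R_{s,k} for s the preorder word of t; the binary search tree of s
   is t by is_bst_preorder, and every other s with that binary search tree gives
   the same set by Rword_bst. *)
Definition R_ n (t : tree) (k : nat) : seq (nat * nat) := Rword n (preorder t) k.

(* The default value is never used for s = R_{t,k} with 1 <= k < n, by maximumP. *)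
Definition maximum (s : seq (nat * nat)) : nat * nat :=
  head (0, 0) [seq m <- s | all (P_le^~ m) s].

Definition i_ n t k : nat := (maximum (R_ n t k)).1.
Definition j_ n t k : nat := (maximum (R_ n t k)).2.

Definition wL n t k (w : 'S_n) : seq nat :=
  [seq a <- word w | i_ n t k <= a <= k].
Definition wR n t k (w : 'S_n) : seq nat :=
  [seq a <- word w | k.+1 <= a <= j_ n t k].

(* nth counts from 0, whence the missing "+ 1" and the extra ".+1" in the two
   subscripts. *)
Definition I_ n t (w : 'S_n) : seq (nat * nat) :=
  [seq x <- P_ n | has (fun k =>
     [&& i_ n t k <= x.1 <= k, k.+1 <= x.2 <= j_ n t k
       & before (word w) (nth 0 (wR t k w) (x.2 - k.+1))
                         (nth 0 (wL t k w) (x.1 - i_ n t k))])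
   (iota 1 n.-1)].

Definition tree_le n t : rel 'S_n := fun v w => all [in I_ t w] (I_ t v).

Lemma is_bst_preorder t : sorted ltn (inorder t) -> is_bst (preorder t) t.
Proof.
have perm_pre u : perm_eq (preorder u) (inorder u).
  elim: u => //= l IHl x r IHr.
  by rewrite perm_sym -cat1s perm_catCA /= perm_cons perm_sym perm_cat.
elim: t => /= [_|l IHl x r IHr]; first exact: bst_nil.
rewrite (sorted_pairwise ltn_trans) pairwise_cat /= allrel_consr.
rewrite -!(sorted_pairwise ltn_trans).
case/and3P=> /andP[lx _] sl /andP[xr sr].
have{}lx : all (ltn^~ x) (preorder l) by rewrite (perm_all _ (perm_pre l)).
have{}xr : all (ltn x) (preorder r) by rewrite (perm_all _ (perm_pre r)).
have filter_none (p q : pred nat) s :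
    (forall y, p y -> ~~ q y) -> all p s -> filter q s = [::].
  move=> pq /allP ps; apply/eqP; rewrite -(negbK (_ == _)) -has_filter.
  by apply/hasPn => y /ps /pq.
constructor; rewrite filter_cat.
- rewrite (all_filterP lx) (filter_none (ltn x)) ?cats0 //; first exact: IHl.
  by move=> y /= xy; rewrite -leqNgt ltnW.
- rewrite (all_filterP xr) (filter_none (ltn^~ x)) ?cat0s //; first exact: IHr.
  by move=> y /= yx; rewrite -leqNgt ltnW.
Qed.

Lemma Rword_bst n s t k : is_bst s t -> Rword n s k = R_ n t k.
Proof.
move=> st; apply: eq_filter => x; case kx: (P_le _ x) => //=.
have first_letter u : all (fun l => ~~ P_le (l, l.+1) x) (take (index k u) u)
    = (head k [seq l <- u | P_le (l, l.+1) x] == k).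
  elim: u => /= [|a u IHu]; first by rewrite eqxx.
  have [->|ak] := eqVneq a k; first by rewrite kx /= eqxx.
  by rewrite /=; case: ifP => /= _; rewrite ?IHu ?(negPf ak).
rewrite !first_letter; congr (_ == _); elim: st => //= {}s u l r sl IHl sr IHr.
case: ifP => //= sx.
have sub v q : is_bst v q -> {subset preorder q <= v}.
  elim=> //= {sx sl sr IHl IHr} a v' l' r' _ IHl _ IHr y.
  rewrite !inE mem_cat => /or3P[->//|/IHl|/IHr];
    by rewrite mem_filter => /andP[_ ->]; rewrite orbT.
have below a : a \in preorder l -> a < s.
  by move/(sub _ _ sl); rewrite mem_filter => /andP[].
have above a : a \in preorder r -> s < a.
  by move/(sub _ _ sr); rewrite mem_filter => /andP[].
have no_filter q : (forall a, a \in q -> ~~ P_le (a, a.+1) x) ->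
    [seq a <- q | P_le (a, a.+1) x] = [::].
  by move=> qx; apply/eqP; rewrite -(negbK (_ == _)) -has_filter; apply/hasPn.
rewrite filter_cat; move: kx sx IHl IHr; rewrite /P_le /= => /andP[xk kx].
case: (leqP x.1 s) => /= [xs /negbT | sx _ _]; last first.
  rewrite -filter_predI => IHr.
  rewrite [X in X ++ _]no_filter; last first.
    by move=> a /below as_; rewrite /P_le /= negb_and -ltnNge (ltn_trans as_ sx).
  rewrite cat0s -IHr; congr head; apply: eq_filter => a /=.
  by case: (leqP x.1 a) => //= xa; rewrite (leq_trans sx xa) andbT.
rewrite -leqNgt -filter_predI => sx IHl _.
rewrite [X in _ ++ X]no_filter; last first.
  move=> a /above sa; rewrite /P_le /= negb_and -!ltnNge ltnS.
  by rewrite (leq_trans sx (ltnW sa)) orbT.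
rewrite cats0 -IHl; congr head; apply: eq_filter => a /=.
case: (ltnP a x.2) => [ax|_]; last by rewrite andbF.
by rewrite (leq_trans ax sx) !andbT.
Qed.

Lemma maximumP n t k : 0 < k < n ->
  (maximum (R_ n t k) \in R_ n t k) /\
  {in R_ n t k, forall x, P_le x (maximum (R_ n t k))}.
Proof.
move=> /andP[k0 kn]; set s := R_ n t k.
have P_E x : (x \in P_ n) = (0 < x.1 < x.2) && (x.2 <= n).
  rewrite mem_filter; apply/andP/andP => [[xx /allpairsP[[i j] /=]]|].
    by rewrite !mem_iota !add1n !ltnS => -[/andP[? _] /andP[_ ?] e]; 
       rewrite e /= in xx *; rewrite xx; split; [apply/andP|].
  case=> /andP[x0 xx] xn; split=> //; apply/allpairsP; exists x.
  rewrite !mem_iota !add1n !ltnS x0 xn (ltn_trans x0 xx).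
  by rewrite (leq_trans (ltnW xx) xn); case: x {x0 xx xn}.
have sE x : (x \in s) = [&& 0 < x.1, x.2 <= n, x.1 <= k < x.2 &
    all (fun l => ~~ (x.1 <= l < x.2)) (take (index k (preorder t)) (preorder t))].
  rewrite mem_filter P_E /P_le /=; case: (leqP x.1 k) => //= xk; rewrite ?andbF //.
  case: (ltnP k x.2) => //= kx; rewrite ?andbF //.
  by rewrite (leq_ltn_trans xk kx) andbT andbC andbA.
have ks : (k, k.+1) \in s.
  rewrite sE /= k0 kn !leqnn /=; apply/allP => l /=; rewrite ltnS -eqn_leq => ls.
  apply: contraL ls => /eqP <-; elim: (preorder t) => //= a u IHu.
  by case: eqVneq => //= ak; rewrite inE negb_or IHu eq_sym ak.
have join_s x y : x \in s -> y \in s -> (minn x.1 y.1, maxn x.2 y.2) \in s.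
  rewrite !sE /= => /and4P[x0 xn /andP[xk kx] /allP ux].
  move=> /and4P[y0 yn /andP[yk ky] /allP uy].
  rewrite leq_min x0 y0 geq_max xn yn geq_min xk leq_max kx /=.
  apply/allP => l lu; apply/andP => -[]; rewrite geq_min leq_max.
  move=> xyl lxy; have := ux l lu; have := uy l lu.
  case: (leqP l k) xyl lxy => [lk|/ltnW kl] xyl lxy.
    rewrite (leq_ltn_trans lk kx) (leq_ltn_trans lk ky) !andbT.
    by case/orP: xyl => ->.
  rewrite (leq_trans xk kl) (leq_trans yk kl) /=.
  by case/orP: lxy => ->.
have [m ms mmax] : exists2 m, m \in s & all (P_le^~ m) s.
  suff: forall u, {subset u <= s} -> exists2 m, m \in s & all (P_le^~ m) u by apply.
  elim=> [_|a u IHu us]; first by exists (k, k.+1).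
  have [|m ms /allP mu] := IHu; first by move=> y yu; apply: us; rewrite inE yu orbT.
  exists (minn a.1 m.1, maxn a.2 m.2).
    by apply: join_s => //; apply: us; rewrite inE eqxx.
  rewrite /= /P_le /= geq_minl leq_maxl; apply/allP => y /mu /andP[my ym].
  by rewrite /= geq_min my leq_max ym !orbT.
have : maximum s \in [seq m <- s | all (P_le^~ m) s].
  have : m \in [seq m <- s | all (P_le^~ m) s] by rewrite mem_filter mmax.
  by rewrite /maximum; case: [seq m <- s | _] => //= a u _; rewrite inE eqxx.
by rewrite mem_filter => /andP[/allP ? ?].
Qed.

Lemma distributive_latticeI n (le : rel 'S_n) (meet join : 'S_n -> 'S_n -> 'S_n) :
    reflexive le -> antisymmetric le -> transitive le ->
    (forall x y z, le z (meet x y) = le z x && le z y) ->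
    (forall x y z, le (join x y) z = le x z && le y z) ->
    left_distributive meet join ->
  distributive_lattice le.
Proof.
move=> le_refl le_anti le_trans leI leU meetUl.
have eqle x y : (forall z, le z x = le z y) -> x = y.
  by move=> h; apply: le_anti; rewrite -h le_refl h le_refl.
have eqge x y : (forall z, le x z = le y z) -> x = y.
  by move=> h; apply: le_anti; rewrite h le_refl -h le_refl.
have leIl x y : le (meet x y) x by have := le_refl (meet x y); rewrite leI => /andP[].
have leUl x y : le x (join x y) by have := le_refl (join x y); rewrite leU => /andP[].
have meetE x y : le x y = (meet x y == x).
  apply/idP/eqP => [xy|<-].
    by apply: le_anti; rewrite leIl leI le_refl xy.
  by have := le_refl (meet x y); rewrite leI => /andP[].
have ltE x y : (y != x) && le x y = (y != x) && le x y by [].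
have mC : commutative meet by move=> x y; apply: eqle => z; rewrite !leI andbC.
have jC : commutative join by move=> x y; apply: eqge => z; rewrite !leU andbC.
have mA : associative meet by move=> x y z; apply: eqle => u; rewrite !leI andbA.
have jA : associative join by move=> x y z; apply: eqge => u; rewrite !leU andbA.
have jK y x : meet x (join x y) = x by apply/eqP; rewrite -meetE.
have mK y x : join x (meet x y) = x.
  by apply: le_anti; rewrite leUl leU le_refl leIl.
have mxx : idempotent_op meet by move=> x; apply/eqP; rewrite -meetE.
pose mix := Order.isMeetJoinDistrLattice.Build (Order.Disp tt tt) 'S_n
  meetE ltE mC jC mA jA jK mK meetUl mxx.
pose L : distrLatticeType (Order.Disp tt tt) := HB.pack 'S_n (Choice.on 'S_n) mix.
by exists (Order.Disp tt tt), (Order.DistrLattice.class L).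
Qed.

(* Main.v *)
Require Import Defs.
From mathcomp Require Import all_boot all_order all_fingroup zify.

(* In a finite distributive lattice an element x is determined by the set D x of
   join-primes below it; joins and meets become unions and intersections, and a
   cover adds exactly one element to D, its label.  By the Bruhat bound, the
   elements of S_n between two words that differ only by rearranging a block of
   consecutive letters are again rearrangements of that block.  Hence every step
   of the weak order is a cover, opposite sides of a square of commuting
   adjacent swaps have equal labels, and in the hexagon of the words of x < y < z the
   two atoms yxz and xzy have join yzx or zxy.  These two types of hexagon
   determine how labels are carried from one side to the other.

   The interval formed by the rearrangements of four letters a < b < c < d has 8
   hexagons.  Going round the octagon of reduced words of its top element, and
   using closure under join and meet, only 5 of the 2^8 assignments of types
   survive: the type of a hexagon depends only on the triple of letters, and the
   types of abc, abd, acd, bcd are those given by one of the 5 trees with 3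
   nodes.  So there is a function cut such that x < y < z has the first type iff
   y <= cut x z, and cut x z is the top node of a tree t between x and z.

   Moving letters through squares and hexagons, the label of the swap of x and y
   depends only on k = cut x y, the number of letters of [i_k, k] before x and the
   number of letters of [k+1, j_k] before y.  This triple is the element that the
   swap adds to I_t, so D v is the image of I_t v under an injection
   that does not depend on v, up to the constant set D id. *)

Set Implicit Arguments.
Unset Strict Implicit.
Unset Printing Implicit Defensive.

(** * Join-primes of a finite distributive lattice *)

Section JoinPrimes.

Variables (T : finType) (le : rel T) (meet join : T -> T -> T).
Hypotheses (le_refl : reflexive le) (le_anti : antisymmetric le).
Hypothesis le_trans : transitive le.
Hypothesis leI : forall x y z, le z (meet x y) = le z x && le z y.
Hypothesis leU : forall x y z, le (join x y) z = le x z && le y z.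
Hypothesis meetUr : right_distributive meet join.

(** The least element qualifies as well; it lies in every [primes_below x]. *)
Definition join_prime j :=
  [forall x, forall y, le j (join x y) ==> le j x || le j y].

Definition primes_below x := [set j | le j x && join_prime j].

Let lexU x y : le x (join x y) /\ le y (join x y).
Proof. by have := le_refl (join x y); rewrite leU => /andP[]. Qed.

Let meetK x y : le x y -> meet x y = x.
Proof.
move=> xy; apply: le_anti; rewrite leI le_refl xy.
by have := le_refl (meet x y); rewrite leI => /andP[->].
Qed.

Lemma primes_below_join x y :
  primes_below (join x y) = primes_below x :|: primes_below y.
Proof.
have [xU yU] := lexU x y; apply/setP => j; rewrite !inE -andb_orl.
apply/andP/andP => -[jU jp]; split=> //.
  by move/forallP/(_ x)/forallP/(_ y)/implyP: jp; apply.
by case/orP: jU => jx; [apply: le_trans xU | apply: le_trans yU].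
Qed.

Lemma primes_below_meet x y :
  primes_below (meet x y) = primes_below x :&: primes_below y.
Proof.
by apply/setP => j; rewrite !inE leI; case: join_prime; rewrite ?andbF ?andbT.
Qed.

(** If [x] is not below [y], a minimal [z] below [x] but not below [y] is join-prime: were [z] below
    [join a b] but below neither, distributivity would make it the join of [meet z a] and
    [meet z b], which are strictly smaller, hence both below [y]. *)
Lemma le_primes_below x y : le x y = (primes_below x \subset primes_below y).
Proof.
apply/idP/subsetP => [xy j|sxy].
  by rewrite !inE => /andP[jx ->]; rewrite (le_trans jx).
apply/negP => /negP nxy.
have : exists z, le z x && ~~ le z y by exists x; rewrite le_refl.
case=> z0 Pz0.
case: (@arg_minnP _ z0 (fun z => le z x && ~~ le z y) (fun z => #|[pred u | le u z]|) Pz0).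
move=> z /andP[zx nzy] zmin.
suff zp : join_prime z by have := sxy z; rewrite !inE zx zp (negPf nzy) => /(_ isT).
apply/forallP => a; apply/forallP => b; apply/implyP => zab.
have below c : ~~ le z c -> le (meet z c) y.
  move=> nzc; apply: contraT => ncy.
  have mz : le (meet z c) z by have := le_refl (meet z c); rewrite leI => /andP[].
  have /zmin : le (meet z c) x && ~~ le (meet z c) y by rewrite ncy (le_trans mz).
  rewrite leqNgt proper_card //; apply/properP; split.
    by apply/subsetP => u; rewrite !inE leI => /andP[].
  by exists z; rewrite ?inE ?leI ?le_refl.
apply: contraT; rewrite negb_or => /andP[nza nzb].
by move: nzy; rewrite -(meetK zab) meetUr leU !below.
Qed.

Lemma primes_below_inj : injective primes_below.
Proof.
by move=> x y e; apply: le_anti; rewrite !le_primes_below e subxx.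
Qed.

(** A new prime joined with [x] gives [y]. So of two new primes each lies below the join of [x] with
    the other, hence below the other, and they coincide. *)
Lemma primes_below_cover x y :
    x != y -> le x y -> (forall z, le x z -> le z y -> z = x \/ z = y) ->
  exists2 p, p \notin primes_below x & primes_below y = p |: primes_below x.
Proof.
move=> nxy xy cov; have sxy : primes_below x \subset primes_below y.
  by rewrite -le_primes_below.
have [/eqP e | [p]] := set_0Vmem (primes_below y :\: primes_below x).
  rewrite setD_eq0 -le_primes_below in e.
  by case/eqP: nxy; apply: le_anti; rewrite xy.
rewrite inE => /andP[px py]; exists p => //.
have above q : q \in primes_below y -> q \notin primes_below x -> join x q = y.
  rewrite !inE => /andP[qy ->]; rewrite andbT => qx.
  case: (lexU x q) => xU qU.
  case: (cov (join x q)) => //; first by rewrite leU xy.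
  by move=> e; rewrite e (negPf qx) in qU.
have lepq q q' : q \in primes_below y -> q \notin primes_below x ->
    q' \in primes_below y -> q' \notin primes_below x -> le q q'.
  move=> qy qx q'y q'x; move: qx qy; rewrite !inE => qx /andP[qy qp].
  rewrite qp andbT in qx.
  move/forallP/(_ x)/forallP/(_ q')/implyP: qp.
  by rewrite (above q') // qy (negPf qx) => /(_ isT).
apply/setP => q; rewrite in_setU1; have [->|qp /=] := eqVneq q p; first by rewrite py.
apply/idP/idP => [qy|]; last by apply: (subsetP sxy).
apply: contraNT qp => qx; apply/eqP/le_anti.
by rewrite !lepq.
Qed.

End JoinPrimes.

(** Birkhoff's representation: from here on the lattice is a family of sets closed under union and
    intersection. *)
Lemma distributive_lattice_sets (T : finType) (le : rel T) :
    distributive_lattice le -> exists D : T -> {set T},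
  [/\ injective D, forall x y, le x y = (D x \subset D y),
      forall x y, exists z, D z = D x :|: D y,
      forall x y, exists z, D z = D x :&: D y &
      forall x y, x != y -> le x y ->
        (forall z, le x z -> le z y -> z = x \/ z = y) ->
        exists2 p, p \notin D x & D y = p |: D x].
Proof.
case=> d [L leE]; pose LT := Order.DistrLattice.Pack L.
pose meet : T -> T -> T := @Order.meet d LT.
pose join : T -> T -> T := @Order.join d LT.
have le_refl : reflexive le by move=> x; rewrite leE Order.POrderTheory.lexx.
have le_anti : antisymmetric le.
  by move=> x y; rewrite !leE => /(@Order.POrderTheory.le_anti d LT).
have le_trans : transitive le.
  by move=> x y z; rewrite !leE; apply: (@Order.POrderTheory.le_trans d LT).
have leI x y z : le z (meet x y) = le z x && le z y.
  by rewrite !leE (@Order.MeetTheory.lexI d LT).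
have leU x y z : le (join x y) z = le x z && le y z.
  by rewrite !leE (@Order.JoinTheory.leUx d LT).
have meetUr : right_distributive meet join.
  exact: (@Order.DistrLatticeTheory.meetUr d LT).
exists (primes_below le join); split.
- exact: (@primes_below_inj T le meet join).
- exact: (@le_primes_below T le meet join).
- by move=> x y; exists (join x y); apply: primes_below_join.
- by move=> x y; exists (meet x y); apply: (@primes_below_meet T le meet join).
- exact: (@primes_below_cover T le meet join).
Qed.

(** * Words and the Bruhat order *)

Lemma size_word n (w : 'S_n) : size (word w) = n.
Proof. by rewrite size_map size_enum_ord. Qed.

Lemma nth_word n (w : 'S_n) (i : 'I_n) : nth 0 (word w) i = (w i).+1.
Proof. by rewrite (nth_map i) ?size_enum_ord // nth_ord_enum. Qed.

Lemma word_inj n : injective (@word n).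
Proof.
move=> v w e; apply/permP => i; apply: val_inj.
by have := nth_word v i; rewrite e nth_word => -[].
Qed.

Lemma perm_eq_word n (w : 'S_n) : perm_eq (word w) (iota 1 n).
Proof.
have uw : uniq (word w).
  by rewrite map_inj_uniq ?enum_uniq // => i j [] /val_inj /perm_inj.
have sub : {subset word w <= iota 1 n}.
  by move=> x /mapP[i _ ->]; rewrite mem_iota /=; have := ltn_ord (w i); lia.
apply: uniq_perm; rewrite ?iota_uniq //.
by have [|_] := uniq_min_size uw sub; rewrite // size_iota size_word.
Qed.

Lemma word_surj n s : perm_eq s (iota 1 n) -> exists w : 'S_n, word w = s.
Proof.
move=> sn; have szs : size s = n by rewrite (perm_size sn) size_iota.
have us : uniq s by rewrite (perm_uniq sn) iota_uniq.
have lts (i : 'I_n) : (nth 0 s i).-1 < n.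
  have : nth 0 s i \in iota 1 n by rewrite -(perm_mem sn) mem_nth ?szs.
  by rewrite mem_iota; lia.
have gts (i : 'I_n) : (nth 0 s i).-1.+1 = nth 0 s i.
  have : nth 0 s i \in iota 1 n by rewrite -(perm_mem sn) mem_nth ?szs.
  by rewrite mem_iota; lia.
have f_inj : injective (fun i => Ordinal (lts i)).
  move=> i j [] /(congr1 S); rewrite !gts => /eqP.
  by rewrite nth_uniq ?szs // => /eqP /val_inj.
exists (perm f_inj); apply: (@eq_from_nth _ 0); rewrite size_word // => i ltin.
by rewrite (nth_word _ (Ordinal ltin)) permE /= (gts (Ordinal ltin)).
Qed.

Definition swap (a b x : nat) := if x == a then b else if x == b then a else x.

Lemma swapK a b : involutive (swap a b).
Proof.
move=> x; rewrite /swap; have [->|xa] := eqVneq x a; first by rewrite eqxx; case: eqVneq.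
by have [->|xb] := eqVneq x b; rewrite ?eqxx // (negPf xa) (negPf xb).
Qed.

(** Products act from left to right, so the transposition exchanges two letters of the word, not two
    positions. *)
Lemma word_tperm n (v : 'S_n) (a b : 'I_n) :
  word (v * tperm a b)%g = map (swap a.+1 b.+1) (word v).
Proof.
rewrite -map_comp; apply: eq_map => i /=; rewrite permM /swap !eqSS.
case: tpermP => [->|->|/eqP va /eqP vb]; rewrite ?eqxx //.
  by case: eqVneq => // ->.
by rewrite -!val_eqE /= in va vb; rewrite (negPf va) (negPf vb).
Qed.

Lemma mem_P n x : (x \in P_ n) = (0 < x.1 < x.2) && (x.2 <= n).
Proof.
rewrite mem_filter; apply/andP/andP => [[xx /allpairsP[[i j] /=]]|].
  by rewrite !mem_iota => -[i0 jn e]; rewrite e /= in xx *; lia.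
case: x => i j /= [/andP[i0 ij] jn]; split=> //.
by apply/allpairsP; exists (i, j); rewrite !mem_iota /=; split=> //; lia.
Qed.

Lemma mem_filter_P n (p : pred (nat * nat)) x :
  (x \in [seq y <- P_ n | p y]) = [&& p x, 0 < x.1 < x.2 & x.2 <= n].
Proof. by rewrite mem_filter mem_P. Qed.

Lemma P_uniq n : uniq (P_ n).
Proof.
by apply: filter_uniq; apply: allpairs_uniq; rewrite ?iota_uniq // => -[? ?] [? ?].
Qed.

(** Exchanging the letters [a] and [b] inside a pair maps the inversions of the new word injectively
    to those of [s]; a pair whose order this would reverse is left as it is. *)
Lemma size_inversions_swap n a b (s : seq nat) :
    0 < a < b -> b <= n -> index b s < index a s ->
  size [seq x <- P_ n | before (map (swap a b) s) x.2 x.1]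
    <= size [seq x <- P_ n | before s x.2 x.1].
Proof.
move=> ab bn ba; set s' := map _ _.
have index_s' x : index x s' = index (swap a b x) s.
  by rewrite -{1}(swapK a b x) index_map //; apply: inv_inj; apply: swapK.
pose f (x : nat * nat) :=
  let y := (swap a b x.1, swap a b x.2) in if y.1 < y.2 then y else x.
have sK := swapK a b.
have f_inj : {in [seq x <- P_ n | before s' x.2 x.1] &, injective f}.
  move=> [i j] [i' j']; rewrite !mem_filter_P /f /= => /and3P[_ ij _].
  case/and3P => [_ ij' _]; have sI := can_inj sK.
  case: ltnP => sij; case: ltnP => sij' [ei ej].
  - by rewrite (sI _ _ ei) (sI _ _ ej).
  - by subst; move: sij'; rewrite !sK; lia.
  - by subst; move: sij; rewrite !sK; lia.
  - by rewrite ei ej.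
have uf : uniq [seq f x | x <- [seq x <- P_ n | before s' x.2 x.1]].
  by rewrite map_inj_in_uniq // filter_uniq // P_uniq.
rewrite -(size_map f); apply: (uniq_leq_size uf) => x /mapP[[i j] + ->].
rewrite !mem_filter_P /before /f /= !index_s' => /andP[ij iP].
case: (ltnP (swap a b i) (swap a b j)) => /= sij.
  rewrite ij sij andTb; move: iP; rewrite /swap.
  by case: (eqVneq i a); case: (eqVneq i b); case: (eqVneq j a); case: (eqVneq j b); lia.
rewrite iP andbT; move: ij sij; rewrite /swap.
have [ia|ia] := eqVneq i a; have [ja|ja] := eqVneq j a;
  have [ib|ib] := eqVneq i b; have [jb|jb] := eqVneq j b; subst; lia.
Qed.

(* The Bruhat order increases these counts; only this half of the tableau
   criterion is needed. *)
Definition prefix_count (m p : nat) (s : seq nat) := count (leq m) (take p s).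

Lemma prefix_count_swap m p a b X Y Z : a < b ->
  prefix_count m p (X ++ a :: Y ++ b :: Z) <= prefix_count m p (X ++ b :: Y ++ a :: Z).
Proof.
move=> ab; rewrite /prefix_count; elim: X p => [|x X IH] [|p] //=; last first.
  by rewrite leq_add2l IH.
suff: count (leq m) (take p (Y ++ b :: Z)) + (m <= a) <=
  count (leq m) (take p (Y ++ a :: Z)) + (m <= b) by lia.
by elim: Y p => [|y Y IH] [|p] //=; [lia|lia|lia|have := IH p; lia].
Qed.

Lemma bruhat_le_prefix_count n (v w : 'S_n) : bruhat_le v w ->
  forall m p, prefix_count m p (word v) <= prefix_count m p (word w).
Proof.
case/connectP => r + -> {w} m p; elim: r v => //= u r IH v.
case/andP=> /andP[/existsP[a /existsP[b /eqP e]] sz] /IH; apply: leq_trans.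
move: sz; rewrite {}e {u r IH}.
wlog ab : a b / a < b => [H|].
  case: (ltngtP a b) => [||/val_inj ->]; first exact: H.
    by rewrite tpermC; apply: H.
  by rewrite tperm1 mulg1 ltnn.
rewrite /inversions word_tperm => sz.
have mem_v (c : 'I_n) : c.+1 \in word v.
  by rewrite (perm_mem (perm_eq_word v)) mem_iota; have := ltn_ord c; lia.
(* By [size_inversions_swap], the growing number of inversions forces the smaller letter to come
   first. *)
have {sz} : index a.+1 (word v) < index b.+1 (word v).
  rewrite ltnNge; apply/negP; rewrite leq_eqVlt => /orP[/eqP e|ba].
    have := nth_index 0 (mem_v a); rewrite -e nth_index ?mem_v //; lia.
  by move: sz; rewrite ltnNge size_inversions_swap // ltn_ord.
have := mem_v b; have := mem_v a; have : uniq (word v).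
  by rewrite (perm_uniq (perm_eq_word v)) iota_uniq.
move: (word v) => s {mem_v v} us sa; case/splitPr: sa us => X Z.
rewrite cat_uniq /= => /and4P[_ Xa aZ uZ] sb ltab.
have : b.+1 \in Z.
  move: sb ltab; rewrite mem_cat !index_cat /= inE eqxx.
  move: Xa; rewrite negb_or => /andP[/negPf -> _]; case: ifP => /= [bX _|_].
    by move=> /ltnW; rewrite addn0 leqNgt index_mem bX.
  by case/orP => // /eqP e _; exfalso; lia.
move=> sbZ; case/splitPr: sbZ Xa aZ uZ {sb ltab} => Y {}Z Xa aZ uZ.
rewrite map_cat /= map_cat /=.
have swap_id W : a.+1 \notin W -> b.+1 \notin W -> map (swap a.+1 b.+1) W = W.
  move=> aW bW; rewrite -[RHS]map_id; apply/eq_in_map => x xW; rewrite /swap.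
  by rewrite !ifN //; [apply: contraNneq bW => <- | apply: contraNneq aW => <-].
move: Xa aZ uZ; rewrite mem_cat inE !negb_or cat_uniq /= has_cat /= negb_or negb_or.
case/and4P=> Xa _ Xb _ /and3P[aY _ aZ] /and4P[uY bY bZ uZ].
rewrite negb_or in bY; case/andP: bY => bY _.
rewrite !swap_id // /swap !eqxx.
have -> : (b.+1 == a.+1) = false by lia.
by rewrite prefix_count_swap.
Qed.

Lemma prefix_countS m i s : i < size s ->
  prefix_count m i.+1 s = prefix_count m i s + (m <= nth 0 s i).
Proof. by move=> si; rewrite /prefix_count (take_nth 0) // -cats1 count_cat /= addn0. Qed.

(** Consecutive prefix counts differ by whether the letter at position [i] is at least [m]; these
    tests determine the letter. *)
Lemma prefix_count_nth i s t : i < size s -> i < size t ->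
    (forall m, prefix_count m i s = prefix_count m i t) ->
    (forall m, prefix_count m i.+1 s = prefix_count m i.+1 t) ->
  nth 0 s i = nth 0 t i.
Proof.
move=> si ti e e1; have leE m : (m <= nth 0 s i) = (m <= nth 0 t i).
  by have := e1 m; rewrite !prefix_countS // e => /addnI; case: (m <= _); case: (m <= _).
by apply: anti_leq; rewrite leE leqnn -leE leqnn.
Qed.

(** Prefixes that do not end strictly inside the block have the same counts in both bounds, so [z]
    has these counts too and agrees with [A] and [B] outside the block. *)
Lemma prefix_count_interval (A u u' B z : seq nat) :
    perm_eq u u' -> perm_eq z (A ++ u ++ B) ->
    (forall m p, prefix_count m p (A ++ u ++ B) <= prefix_count m p z) ->
    (forall m p, prefix_count m p z <= prefix_count m p (A ++ u' ++ B)) ->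
  exists2 u'', perm_eq u u'' & z = A ++ u'' ++ B.
Proof.
move=> uu' zs le1 le2; set s := A ++ u ++ B in zs le1.
have sz : size z = size s by apply: perm_size.
have szu : size u = size u' by apply: perm_size.
have eq_cnt m p : (p <= size A) || (size A + size u <= p) ->
    prefix_count m p z = prefix_count m p s.
  move=> pA; apply/anti_leq; rewrite le1 andbT; apply: leq_trans (le2 m p) _.
  rewrite leq_eqVlt; apply/orP; left; apply/eqP.
  rewrite /prefix_count /s !take_cat -szu.
  case: ltnP => [//|Ap]; case: ltnP => [pu|up].
    have -> : p - size A = 0 by lia.
    by rewrite !take0.
  by rewrite !count_cat (seq.permP uu').
have eq_nth i : i < size s -> (i < size A) || (size A + size u <= i) ->
    nth 0 z i = nth 0 s i.
  move=> si iA; apply: prefix_count_nth => //; first by rewrite sz.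
    by move=> m; apply: eq_cnt; lia.
  by move=> m; apply: eq_cnt; lia.
have ss : size s = size A + (size u + size B) by rewrite !size_cat.
have takeA : take (size A) z = A.
  have szA : size (take (size A) z) = size A by rewrite size_takel; lia.
  apply: (@eq_from_nth _ 0) => [//|i]; rewrite szA => iA.
 
  by rewrite nth_take // eq_nth ?iA ?nth_cat ?iA //; lia.
have dropB : drop (size u + size A) z = B.
  apply: (@eq_from_nth _ 0) => [|i]; rewrite size_drop; first by lia.
  move=> iB; rewrite nth_drop eq_nth; [|lia|lia].
  by rewrite /s !nth_cat; do 2!case: ltnP; (try lia) => _ _; congr nth; lia.
have zE : z = A ++ take (size u) (drop (size A) z) ++ B.
  rewrite -{1}(cat_take_drop (size A) z) takeA.
  by rewrite -{1}(cat_take_drop (size u) (drop (size A) z)) drop_drop dropB.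
exists (take (size u) (drop (size A) z)) => //.
by move: zs; rewrite {1}zE /s perm_cat2l perm_cat2r perm_sym.
Qed.

Lemma before_block (A u u' B : seq nat) (x y : nat) :
  perm_eq u u' -> ~~ ((x \in u) && (y \in u)) ->
  before (A ++ u ++ B) x y = before (A ++ u' ++ B) x y.
Proof.
move=> uu'; have szu : size u = size u' by apply: perm_size.
have index_catE (a : nat) (s t : seq nat) : index a (s ++ t) =
    if a \in s then index a s else size s + index a t by rewrite index_cat.
rewrite /before !index_catE -!(perm_mem uu') -szu.
have idx (s : seq nat) (a : nat) : a \in s -> index a s < size s.
  by rewrite index_mem.
have idx' (a : nat) : a \in u -> index a u' < size u.
  by rewrite (perm_mem uu') szu; apply: idx.
case xA: (x \in A); case yA: (y \in A) => //.
- by have := idx _ _ xA; case: (y \in u); lia.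
- by have := idx _ _ yA; case: (x \in u); lia.
case xu: (x \in u); case yu: (y \in u) => //= _; rewrite !ltn_add2l.
- by have := idx _ _ xu; have := idx' _ xu; lia.
- by have := idx _ _ yu; have := idx' _ yu; lia.
Qed.

Lemma before_in_block (A u B : seq nat) x y : uniq (A ++ u ++ B) ->
  x \in u -> y \in u -> before (A ++ u ++ B) x y = (index x u < index y u).
Proof.
rewrite cat_uniq => /and3P[_ /hasPn uA _] xu yu.
have notA a : a \in u -> (a \in A) = false.
  by move=> au; apply/negbTE/uA; rewrite mem_cat au.
by rewrite /before !index_cat !notA // xu yu ltn_add2l.
Qed.

(** Only pairs of letters inside the block can change order; an increasing [u] has no inversion
    there and a decreasing [u'] has them all. *)
Lemma weak_le_block n (v w : 'S_n) (A u u' B : seq nat) :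
    perm_eq u u' -> word v = A ++ u ++ B -> word w = A ++ u' ++ B ->
  sorted ltn u || sorted gtn u' -> weak_le v w.
Proof.
move=> uu' ve we su; apply/allP => -[i j]; rewrite !mem_filter_P /= => /andP[].
rewrite ve we => + /andP[/andP[i0 ij] jn]; rewrite i0 ij jn !andbT.
have [/andP[ju iu]|nu] := boolP ((j \in u) && (i \in u)); last first.
  by rewrite (before_block _ _ uu' nu).
have uv : uniq (A ++ u ++ B) by rewrite -ve (perm_uniq (perm_eq_word v)) iota_uniq.
have uw : uniq (A ++ u' ++ B) by rewrite -we (perm_uniq (perm_eq_word w)) iota_uniq.
rewrite !before_in_block -?(perm_mem uu') //; case/orP: su => su.
  by move/(sorted_ltn_index ltn_trans su _ _ ju iu) => /= ji; lia.
move=> _; rewrite ltnNge leq_eqVlt; apply/negP => /orP[/eqP e|].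
  have := nth_index 0 iu; rewrite (perm_mem uu') in iu; rewrite (perm_mem uu') in ju.
  by have := nth_index 0 ju; rewrite -e nth_index //; lia.
have gtn_trans : transitive gtn by move=> ? ? ? /= h h'; apply: ltn_trans h' h.
by rewrite !(perm_mem uu') in ju iu; move/(sorted_ltn_index gtn_trans su _ _ iu ju) => /= ji; lia.
Qed.

(** The Bruhat bound on the given order enters the proof through this lemma alone. *)
Lemma bruhat_interval_block n (v w z : 'S_n) (A u u' B : seq nat) :
    perm_eq u u' -> word v = A ++ u ++ B -> word w = A ++ u' ++ B ->
    bruhat_le v z -> bruhat_le z w ->
  exists2 u'', perm_eq u u'' & word z = A ++ u'' ++ B.
Proof.
move=> uu' ve we vz zw; apply: (@prefix_count_interval A u u') => // [|m p|m p].
- rewrite -ve; apply: perm_trans (perm_eq_word z) _.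
  by rewrite perm_sym perm_eq_word.
- by rewrite -ve bruhat_le_prefix_count.
- by rewrite -we bruhat_le_prefix_count.
Qed.

Lemma perm_eq_block n (A u u' B : seq nat) : perm_eq u u' ->
  perm_eq (A ++ u ++ B) (iota 1 n) -> perm_eq (A ++ u' ++ B) (iota 1 n).
Proof.
by move=> uu'; apply: perm_trans; rewrite perm_cat2l perm_cat2r perm_sym.
Qed.

(** * Transport of the lattice to words *)

Section Words.

Variables (n : nat) (le : rel 'S_n).
Hypothesis le_distr : distributive_lattice le.
Hypothesis weak_le_le : forall v w : 'S_n, weak_le v w -> le v w.
Hypothesis le_bruhat_le : forall v w : 'S_n, le v w -> bruhat_le v w.

(** Sorting a block in either direction gives weak-order bounds common to all its rearrangements, so
    [bruhat_interval_block] keeps joins and meets among them. A block of two letters has only two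
    rearrangements, whence the covers. *)
Lemma word_sets : exists D : seq nat -> {set 'S_n},
  [/\ forall v w, le v w = (D (word v) \subset D (word w)),
      forall s s' : seq nat, perm_eq s (iota 1 n) -> perm_eq s' (iota 1 n) ->
        D s = D s' -> s = s',
      forall A u u' u'' B : seq nat, perm_eq (A ++ u ++ B) (iota 1 n) ->
        perm_eq u u' -> perm_eq u u'' ->
        exists2 z, perm_eq u z &
          D (A ++ z ++ B) = D (A ++ u' ++ B) :|: D (A ++ u'' ++ B),
      forall A u u' u'' B : seq nat, perm_eq (A ++ u ++ B) (iota 1 n) ->
        perm_eq u u' -> perm_eq u u'' ->
        exists2 z, perm_eq u z &
          D (A ++ z ++ B) = D (A ++ u' ++ B) :&: D (A ++ u'' ++ B) &
      forall (A : seq nat) (x y : nat) (B : seq nat),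
        perm_eq (A ++ x :: y :: B) (iota 1 n) -> x < y ->
        exists2 p, p \notin D (A ++ x :: y :: B) &
          D (A ++ y :: x :: B) = p |: D (A ++ x :: y :: B)].
Proof.
have [D [D_inj leE DU DI Dcov]] := distributive_lattice_sets le_distr.
(* The value [set0] is a default for lists that are not words of permutations. *)
pose DW s := if [pick w : 'S_n | word w == s] is Some w then D w else set0.
have DWE w : DW (word w) = D w.
  rewrite /DW; case: pickP => [v /eqP /word_inj -> //|/(_ w)].
  by rewrite eqxx.
have sort_bot u v (A B : seq nat) : word v = A ++ u ++ B ->
    exists w, [/\ word w = A ++ sort leq u ++ B, sorted ltn (sort leq u) & le w v].
  move=> ve; have pu : perm_eq u (sort leq u) by rewrite perm_sym perm_sort.
  have [w we] : exists w : 'S_n, word w = A ++ sort leq u ++ B.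
    by apply: word_surj; apply: (perm_eq_block pu); rewrite -?ve ?perm_eq_word.
  have su : sorted ltn (sort leq u).
    rewrite ltn_sorted_uniq_leq sort_uniq (sort_sorted leq_total) andbT.
    have := iota_uniq 1 n; rewrite -(perm_uniq (perm_eq_word v)) ve !cat_uniq.
    by case/and3P => _ _ /and3P[].
  exists w; split=> //; apply: weak_le_le.
  by apply: (weak_le_block _ we ve); rewrite ?perm_sort // su.
have sort_top u v (A B : seq nat) : word v = A ++ u ++ B ->
    exists w, [/\ word w = A ++ rev (sort leq u) ++ B & le v w].
  move=> ve; have pu : perm_eq u (rev (sort leq u)).
    by rewrite perm_sym perm_rev perm_sort.
  have [w we] : exists w : 'S_n, word w = A ++ rev (sort leq u) ++ B.
    by apply: word_surj; apply: (perm_eq_block pu); rewrite -?ve ?perm_eq_word.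
  have [_ [_ su _]] := sort_bot _ _ _ _ ve.
  exists w; split=> //; apply: weak_le_le.
  apply: (weak_le_block pu ve we); apply/orP; right.
  by rewrite rev_sorted.
have le_refl v : le v v by rewrite leE.
exists DW; split.
- by move=> v w; rewrite !DWE leE.
- move=> s s' /word_surj[v <-] /word_surj[w <-]; rewrite !DWE.
  by move=> /D_inj ->.
- move=> A u u' u'' B uB uu' uu''.
  have [v ve] := word_surj (perm_eq_block uu' uB).
  have [w we] := word_surj (perm_eq_block uu'' uB).
  have [t [te vt]] := sort_top _ _ _ _ ve.
  have [t' [te' wt]] := sort_top _ _ _ _ we.
  (* The decreasing rearrangement depends only on the letters of the block, so [t] bounds both [v]
     and [w]. *)
  have tt' : t = t'.
    apply: word_inj; rewrite te te'; congr (_ ++ rev _ ++ _).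
    apply/perm_sortP; [exact: leq_total|exact: leq_trans|exact: anti_leq|].
    by apply: perm_trans uu''; rewrite perm_sym.
  rewrite -{}tt' in wt; have [z ze] := DU v w.
  have [|||z' pz' ze'] := @bruhat_interval_block n v t z A u' _ B _ ve te.
  + by rewrite perm_sym perm_rev perm_sort.
  + by apply: le_bruhat_le; rewrite leE ze subsetUl.
  + by apply: le_bruhat_le; rewrite leE ze subUset -!leE vt.
  by exists z'; [apply: perm_trans pz' | rewrite -ve -we -ze' !DWE].
- move=> A u u' u'' B uB uu' uu''.
  have [v ve] := word_surj (perm_eq_block uu' uB).
  have [w we] := word_surj (perm_eq_block uu'' uB).
  have [t [te _ tv]] := sort_bot _ _ _ _ ve.
  have [t' [te' _ tw]] := sort_bot _ _ _ _ we.
  have tt' : t = t'.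
    apply: word_inj; rewrite te te'; congr (_ ++ _ ++ _).
    apply/perm_sortP; [exact: leq_total|exact: leq_trans|exact: anti_leq|].
    by apply: perm_trans uu''; rewrite perm_sym.
  rewrite -{}tt' in tw; have [z ze] := DI v w.
  have [|||z' pz' ze'] := @bruhat_interval_block n t v z A _ u' B _ te ve.
  + by rewrite perm_sort.
  + by apply: le_bruhat_le; rewrite leE ze subsetI -!leE tv.
  + by apply: le_bruhat_le; rewrite leE ze subsetIl.
  exists z'; last by rewrite -ve -we -ze' !DWE.
  by apply: perm_trans uu' (perm_trans _ pz'); rewrite perm_sym perm_sort.
- move=> A x y B xyB xy.
  have pxy : perm_eq [:: x; y] [:: y; x] by rewrite (perm_catC [:: x] [:: y]).
  have [v ve] := word_surj xyB.
  have [w we] := word_surj (perm_eq_block pxy xyB : perm_eq (A ++ y :: x :: B) _).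
  rewrite -ve -we !DWE; apply: Dcov.
  + apply/eqP => /(congr1 (@word n)); rewrite ve we => /eqP.
    by rewrite eqseq_cat // eqxx /= eqseq_cons; lia.
  + by apply: weak_le_le; apply: (weak_le_block pxy ve we); rewrite /= xy.
  move=> z /le_bruhat_le vz /le_bruhat_le zw.
  have [u pu ze] := bruhat_interval_block pxy ve we vz zw.
  have : (u == [:: x; y]) || (u == [:: y; x]).
    have := perm_size pu; case: u pu {ze} => [|a [|b []]] //= pu _.
    have := perm_mem pu a; have := perm_mem pu b; rewrite !inE !eqxx orbT /= => ea eb.
    have : uniq [:: a; b] by rewrite -(perm_uniq pu) /= inE; lia.
    by rewrite /= inE !eqseq_cons !andbT; move: ea eb; lia.
  by case/orP=> /eqP e; [left|right]; apply: word_inj; rewrite ze e ?ve ?we.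
Qed.

End Words.

(** * Squares and hexagons *)

(** Lists are rearrangements of each other when every predicate has equal counts on them, which
    leaves linear arithmetic. *)
Ltac perm_tac :=
  apply/seq.permP => ?; rewrite -?cats1 /= ?count_cat /= ?count_cat /=; clear; lia.

(** Coding rearrangements by lists of positions makes case analysis over them finite and
    computable. *)
Lemma perm_eq_nth (s t : seq nat) : perm_eq s t ->
  exists2 Is, Is \in permutations (iota 0 (size s)) & t = map (nth 0 s) Is.
Proof.
rewrite perm_sym => /(perm_iotaP 0)[Is pI ->]; exists Is => //.
by rewrite mem_permutations.
Qed.

Section Steps.

Variable X : finType.
Implicit Types E F : {set X}.

Definition step E F := exists2 p, p \notin E & F = p |: E.

Lemma setU1D (p : X) E : p \notin E -> (p |: E) :\: E = [set p].
Proof.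
move=> pE; apply/setP => x; rewrite !inE; case: eqVneq => [->|_] /=.
  by rewrite pE.
by rewrite andNb.
Qed.

Lemma step_sub E F : step E F -> E \subset F.
Proof. by case=> p _ ->; apply: subsetUr. Qed.

Lemma step_setD E F : step E F -> exists p, F :\: E = [set p].
Proof. by case=> p pE ->; exists p; apply: setU1D. Qed.

Lemma card_step (E F : {set X}) : step E F -> #|F| = #|E|.+1.
Proof. by case=> p pE ->; rewrite cardsU1 pE. Qed.

Lemma setU_setD E F : E \subset F -> F = E :|: (F :\: E).
Proof.
by move=> /subsetP EF; apply/setP => x; rewrite !inE; case: (boolP (x \in E)) => [/EF ->|_].
Qed.

(** The two atoms add distinct elements and the top has both, so the last step of each path repeats
    the first step of the other. *)
Lemma step_square E0 E1 E2 E3 :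
  step E0 E1 -> step E0 E2 -> step E1 E3 -> step E2 E3 -> E1 <> E2 ->
  E3 :\: E2 = E1 :\: E0.
Proof.
case=> p pE ->; case=> q qE -> [a a1 ->] [b b2 e] ne.
have pq : p != q by apply/eqP => pq; rewrite pq in ne.
have : q \in a |: (p |: E0) by rewrite e !inE eqxx orbT.
rewrite !inE (negPf qE) [q == p]eq_sym (negPf pq) !orbF => /eqP qa.
by rewrite setU1D // -qa setUCA setU1D // !inE negb_or pq.
Qed.

(** If the first path adds [p], [q], [r] in turn, the hypothesis on [E3] makes [q] the first label
    of the other path. Its second label is not [p], since [E3] and [E4] differ, so that path adds
    [q], [r], [p]. *)
Lemma step_hexagon E0 E1 E2 E3 E4 E5 :
    step E0 E1 -> step E1 E3 -> step E3 E5 ->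
    step E0 E2 -> step E2 E4 -> step E4 E5 ->
    E1 <> E2 -> E3 <> E4 -> E3 = E1 :|: E2 ->
  [/\ E1 :\: E0 = E5 :\: E4, E3 :\: E1 = E2 :\: E0 & E5 :\: E3 = E4 :\: E2].
Proof.
case=> p p0 -> [q q1 e3] [r r3 e5] [q' q'0 ->] [s s2 e4] [t t4 e5'] n12 n34 e.
subst E3 E4 E5.
have pq' : p != q' by apply: contra_not_neq n12 => ->.
have qq' : q = q'.
  move/setP/(_ q'): e; rewrite !inE eqxx !orbT (negPf q'0) [q' == p]eq_sym (negPf pq') !orbF.
  by move/eqP->.
subst q'; move: q1 s2 r3 t4 n34; rewrite !inE !negb_or => /andP[qp _].
case/andP=> sq s0 /and3P[rq rp r0] /and3P[ts tq t0] n34.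
have sp : s != p by apply: contra_not_neq n34 => ->; rewrite setUCA.
have sr : s = r.
  move/setP/(_ s): e5'; rewrite !inE eqxx !orbT (negPf sq) (negPf sp) (negPf s0) !orbF.
  by move/eqP.
subst s; have tp : t = p.
  move/setP/(_ t): e5'; rewrite !inE eqxx (negPf ts) (negPf tq) (negPf t0) /= !orbF.
  by move/eqP.
subst t; split.
- rewrite setU1D // e5' setU1D //.
  by rewrite !inE !negb_or ts tq.
- by rewrite !setU1D // !inE negb_or qp.
- by rewrite !setU1D // !inE !negb_or ?rq ?rp ?sq.
Qed.

End Steps.

Notation valid n s := (perm_eq s (iota 1 n)).

(** All that the study of squares, hexagons and labels uses about the lattice, stated for words
    alone. *)
Record compatible n (X : finType) (D : seq nat -> {set X}) : Prop := Compatible {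
  D_inj : forall s s' : seq nat, valid n s -> valid n s' -> D s = D s' -> s = s';
  D_join : forall A u u' u'' B : seq nat, valid n (A ++ u ++ B) ->
    perm_eq u u' -> perm_eq u u'' -> exists2 z, perm_eq u z &
      D (A ++ z ++ B) = D (A ++ u' ++ B) :|: D (A ++ u'' ++ B);
  D_meet : forall A u u' u'' B : seq nat, valid n (A ++ u ++ B) ->
    perm_eq u u' -> perm_eq u u'' -> exists2 z, perm_eq u z &
      D (A ++ z ++ B) = D (A ++ u' ++ B) :&: D (A ++ u'' ++ B);
  D_step : forall (A : seq nat) (x y : nat) (B : seq nat),
    valid n (A ++ x :: y :: B) -> x < y ->
    step (D (A ++ x :: y :: B)) (D (A ++ y :: x :: B))
}.

Section Hexagons.

Variables (n : nat) (X : finType) (D : seq nat -> {set X}).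
Hypothesis HD : compatible n D.
Local Notation valid s := (perm_eq s (iota 1 n)).

(** By [D_step] a singleton for valid words with [x < y]; keeping the set avoids choosing its
    element. *)
Definition lab (A : seq nat) (x y : nat) (B : seq nat) :=
  D (A ++ y :: x :: B) :\: D (A ++ x :: y :: B).

(* [typ] tells which of yzx and zxy is the join of the atoms yxz and xzy. *)
Definition typ (A : seq nat) (x y z : nat) (B : seq nat) :=
  D (A ++ y :: z :: x :: B) == D (A ++ y :: x :: z :: B) :|: D (A ++ x :: z :: y :: B).

Lemma perm_valid (s t : seq nat) : valid s -> perm_eq t s -> valid t.
Proof. by move=> vs ts; apply: perm_trans vs. Qed.

Lemma cat_neq (A s t : seq nat) : s <> t -> A ++ s <> A ++ t.
Proof. by move=> st /eqP; rewrite eqseq_cat // eqxx => /eqP. Qed.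

Lemma square (A B C : seq nat) (x y z t : nat) :
    valid (A ++ x :: y :: B ++ z :: t :: C) -> x < y -> z < t ->
  lab A x y (B ++ z :: t :: C) = lab A x y (B ++ t :: z :: C) /\
  lab (A ++ x :: y :: B) z t C = lab (A ++ y :: x :: B) z t C.
Proof.
move=> v xy zt; rewrite /lab -!catA /=.
have vE A' : A' = A ++ x :: y :: B ++ z :: t :: C -> valid A' by move->.
have s01 := D_step HD v xy.
have s02 : step (D (A ++ x :: y :: B ++ z :: t :: C)) (D (A ++ x :: y :: B ++ t :: z :: C)).
  have := @D_step _ _ _ HD (A ++ x :: y :: B) z t C; rewrite -!catA /=; exact.
have s13 : step (D (A ++ y :: x :: B ++ z :: t :: C)) (D (A ++ y :: x :: B ++ t :: z :: C)).
  have := @D_step _ _ _ HD (A ++ y :: x :: B) z t C; rewrite -!catA /=; apply=> //.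
  by apply: perm_valid v _; perm_tac.
have s23 : step (D (A ++ x :: y :: B ++ t :: z :: C)) (D (A ++ y :: x :: B ++ t :: z :: C)).
  by apply: (D_step HD) => //; apply: perm_valid v _; perm_tac.
have ne : D (A ++ y :: x :: B ++ z :: t :: C) <> D (A ++ x :: y :: B ++ t :: z :: C).
  move=> /(D_inj HD) e; apply: (@cat_neq A _ _ _ (e _ _)) => [[]||]; first lia.
    by apply: perm_valid v _; perm_tac.
  by apply: perm_valid v _; perm_tac.
split; first by rewrite (step_square s01 s02 s13 s23).
by rewrite (step_square s02 s01 s23 s13) // => /esym.
Qed.

Lemma hexagon (A B : seq nat) (x y z : nat) :
    valid (A ++ x :: y :: z :: B) -> x < y -> y < z ->
  if typ A x y z B then
    [/\ lab A x y (z :: B) = lab (rcons A z) x y B,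
        lab (rcons A y) x z B = lab (rcons A x) y z B &
        lab A y z (x :: B) = lab A x z (y :: B)]
  else
    [/\ lab A x y (z :: B) = lab A x z (y :: B),
        lab (rcons A y) x z B = lab (rcons A z) x y B &
        lab A y z (x :: B) = lab (rcons A x) y z B].
Proof.
move=> v xy yz; have xz := ltn_trans xy yz.
have vp u : perm_eq u [:: x; y; z] -> valid (A ++ u ++ B).
  by move=> pu; apply: perm_valid v _; rewrite perm_cat2l (perm_cat2r B u [:: x; y; z]).
have ne u u' : perm_eq u [:: x; y; z] -> perm_eq u' [:: x; y; z] -> u <> u' ->
    D (A ++ u ++ B) <> D (A ++ u' ++ B).
  move=> pu pu' nu /(D_inj HD (vp _ pu) (vp _ pu')); apply: cat_neq.
  by move/eqP; rewrite eqseq_cat ?(perm_size pu) ?(perm_size pu') // => /andP[/eqP].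
have s01 := D_step HD v xy.
have s02 : step (D (A ++ x :: y :: z :: B)) (D (A ++ x :: z :: y :: B)).
  by have := @D_step _ _ _ HD (rcons A x) y z B; rewrite !cat_rcons; apply.
have s13 : step (D (A ++ y :: x :: z :: B)) (D (A ++ y :: z :: x :: B)).
  have := @D_step _ _ _ HD (rcons A y) x z B; rewrite !cat_rcons; apply=> //.
  by apply: (vp [:: y; x; z]); perm_tac.
have s35 : step (D (A ++ y :: z :: x :: B)) (D (A ++ z :: y :: x :: B)).
  by apply: (D_step HD) => //; apply: (vp [:: y; z; x]); perm_tac.
have s24 : step (D (A ++ x :: z :: y :: B)) (D (A ++ z :: x :: y :: B)).
  by apply: (D_step HD) => //; apply: (vp [:: x; z; y]); perm_tac.
have s45 : step (D (A ++ z :: x :: y :: B)) (D (A ++ z :: y :: x :: B)).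
  have := @D_step _ _ _ HD (rcons A z) x y B; rewrite !cat_rcons; apply=> //.
  by apply: (vp [:: z; x; y]); perm_tac.
have n12 : D (A ++ y :: x :: z :: B) <> D (A ++ x :: z :: y :: B).
  by apply: (ne [:: y; x; z] [:: x; z; y]); [perm_tac|perm_tac|case; lia].
have n34 : D (A ++ y :: z :: x :: B) <> D (A ++ z :: x :: y :: B).
  by apply: (ne [:: y; z; x] [:: z; x; y]); [perm_tac|perm_tac|case; lia].
rewrite /lab /typ !cat_rcons; case: eqP => [e|ne3].
  by have [] := step_hexagon s01 s13 s35 s02 s24 s45 n12 n34 e.
(* The union of the atoms has two elements more than the bottom. Among the six words only [yzx] and
   [zxy] have sets of that size, so here the join is at [zxy] and [step_hexagon] applies with the
   paths exchanged. *)
have e : D (A ++ z :: x :: y :: B) = D (A ++ x :: z :: y :: B) :|: D (A ++ y :: x :: z :: B).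
  have [||u pu] := @D_join _ _ _ HD A [:: x; y; z] [:: x; z; y] [:: y; x; z] B v; [perm_tac|perm_tac|].
  have [Is IsP ->] := perm_eq_nth pu.
  have c01 := card_step s01; have c02 := card_step s02; have c13 := card_step s13.
  have c35 := card_step s35; have c24 := card_step s24.
  have cU : #|D (A ++ y :: x :: z :: B) :|: D (A ++ x :: z :: y :: B)|
      = #|D (A ++ x :: y :: z :: B)|.+2.
    case: s01 s02 n12 => p p0 -> [q q0 ->] n12.
    have pq : p != q by apply: contra_not_neq n12 => ->.
    rewrite (_ : _ :|: _ = p |: (q |: D (A ++ x :: y :: z :: B))).
      by rewrite !cardsU1 !inE negb_or pq p0 q0.
    apply/setP => a; rewrite !inE.
    by case: (a == p); case: (a == q); case: (a \in _).
  move: IsP; rewrite (_ : permutations _ = [:: [:: 1; 0; 2]; [:: 0; 1; 2];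
    [:: 2; 0; 1]; [:: 0; 2; 1]; [:: 1; 2; 0]; [:: 2; 1; 0]]) //.
  move=> IsP e; have c := congr1 (fun E : {set X} => #|E|) e.
  move: IsP e c; rewrite [_ :|: D (A ++ y :: x :: z :: B)]setUC cU !inE.
  by case/or4P=> [/eqP->|/eqP->|/eqP->|/or3P[]/eqP->] /= e c; first [lia | by case: ne3 | exact: e].
have [||-> -> ->] := step_hexagon s02 s24 s45 s01 s13 s35 _ _ e.
- by move/esym.
- by move/esym.
by [].
Qed.

End Hexagons.

(** * Rearrangements of four letters *)

(* The sets D at the words abcd, bacd, bcad, bcda, cbda, cdba, dcba form a maximal
   chain.  All 24 sets are Boolean combinations of these seven, hence are given
   by the set of depths j = 0, ..., 7 of their elements, where depth j means
   missing from exactly the first j members of the chain. *)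
Definition profile := seq bool.
Definition profile_op (op : bool -> bool -> bool) (m m' : profile) : profile :=
  mkseq (fun i => op (nth false m i) (nth false m' i)) 8.
Definition profileU := profile_op orb.
Definition profileI := profile_op andb.
Definition profileD := profile_op (fun a b => a && ~~ b).
Definition profile_chain j : profile := mkseq (fun i => i <= j) 8.
(** Opposite sides of a square have equal labels, so the fourth set is a known one plus a known
    difference. In a hexagon [m0] to [m3] stand for [xyz], [yxz], [yzx], [zyx]; [profile_hex1]
    yields [xzy] and [profile_hex2] yields [zxy]. *)
Definition profile_square m0 m1 m2 := profileU m0 (profileD m2 m1).
Definition profile_hex1 t m0 m1 m2 m3 :=
  profileU m0 (if t then profileD m2 m1 else profileD m3 m2).
Definition profile_hex2 t m0 m1 m2 m3 :=
  profileU (profile_hex1 t m0 m1 m2 m3) (if t then profileD m3 m2 else profileD m1 m0).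
(* No element of depth 0 or 7 distinguishes the sets, and none need exist. *)
Definition profile_eq (m m' : profile) :=
  all (fun i => nth false m i == nth false m' i) (iota 1 6).

(* The primed types and words come from the second half of the way round the
   octagon of reduced words of dcba; a word listed twice yields an equation. *)
Definition octagon t1 t2 t3 t4 t1' t2' t3' t4' : seq (seq nat * profile) :=
  let abcd := profile_chain 0 in
  let bacd := profile_chain 1 in
  let bcad := profile_chain 2 in
  let bcda := profile_chain 3 in
  let cbda := profile_chain 4 in
  let cdba := profile_chain 5 in
  let dcba := profile_chain 6 in
  let cbad := profile_square bcad bcda cbda in
  let acbd := profile_hex1 t1 abcd bacd bcad cbad in
  let cabd := profile_hex2 t1 abcd bacd bcad cbad in
  let cadb := profile_hex1 t2 cabd cbad cbda cdba in
  let cdab := profile_hex2 t2 cabd cbad cbda cdba in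
  let acdb := profile_square acbd cabd cadb in
  let dcab := profile_square cdab cdba dcba in
  let adcb := profile_hex1 t3 acdb cadb cdab dcab in
  let dacb := profile_hex2 t3 acdb cadb cdab dcab in
  let abdc := profile_hex1 t4 abcd acbd acdb adcb in
  let adbc := profile_hex2 t4 abcd acbd acdb adcb in
  let bdca := profile_hex1 t4' bcda cbda cdba dcba in
  let dbca := profile_hex2 t4' bcda cbda cdba dcba in
  let badc := profile_hex1 t3' bacd bcad bcda bdca in
  let bdac := profile_hex2 t3' bacd bcad bcda bdca in
  let abdc' := profile_square abcd bacd badc in
  let dbac := profile_square bdac bdca dbca in
  let adbc' := profile_hex1 t2' abdc badc bdac dbac in
  let dabc := profile_hex2 t2' abdc badc bdac dbac in
  let dacb' := profile_hex1 t1' dabc dbac dbca dcba in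
  let dcab' := profile_hex2 t1' dabc dbac dbca dcba in
  let adcb' := profile_square adbc dabc dacb in
  [:: ([:: 0; 1; 2; 3], abcd); ([:: 1; 0; 2; 3], bacd);
      ([:: 1; 2; 0; 3], bcad); ([:: 1; 2; 3; 0], bcda);
      ([:: 2; 1; 3; 0], cbda); ([:: 2; 3; 1; 0], cdba);
      ([:: 3; 2; 1; 0], dcba); ([:: 2; 1; 0; 3], cbad);
      ([:: 0; 2; 1; 3], acbd); ([:: 2; 0; 1; 3], cabd);
      ([:: 2; 0; 3; 1], cadb); ([:: 2; 3; 0; 1], cdab);
      ([:: 0; 2; 3; 1], acdb); ([:: 3; 2; 0; 1], dcab);
      ([:: 0; 3; 2; 1], adcb); ([:: 3; 0; 2; 1], dacb);
      ([:: 0; 1; 3; 2], abdc); ([:: 0; 3; 1; 2], adbc);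
      ([:: 1; 3; 2; 0], bdca); ([:: 3; 1; 2; 0], dbca);
      ([:: 1; 0; 3; 2], badc); ([:: 1; 3; 0; 2], bdac);
      ([:: 0; 1; 3; 2], abdc'); ([:: 3; 1; 0; 2], dbac);
      ([:: 0; 3; 1; 2], adbc'); ([:: 3; 0; 1; 2], dabc);
      ([:: 3; 0; 2; 1], dacb'); ([:: 3; 2; 0; 1], dcab');
      ([:: 0; 3; 2; 1], adcb')].

Definition octagon_closed (o : seq (seq nat * profile)) :=
  if all (fun e => all (fun e' => (e.1 == e'.1) ==> profile_eq e.2 e'.2) o) o then
    all (fun e => all (fun e' =>
      has (fun e'' => profile_eq e''.2 (profileU e.2 e'.2)) o &&
      has (fun e'' => profile_eq e''.2 (profileI e.2 e'.2)) o) o) o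
  else false.

(* The arguments are the types of abc, abd, acd, bcd; the accepted vectors are
   TTTT, FTTT, TTFF, FFFT, FFFF. *)
Definition tree_types (t1 t2 t3 t4 : bool) :=
  if t2 then if t3 then t4 else t1 && ~~ t4 else ~~ t1 && ~~ t3.

(** Checked on all 256 assignments. The equations say that the type of a triple does not change when
    the fourth letter passes from one side to the other. *)
Lemma octagon_types t1 t2 t3 t4 t1' t2' t3' t4' :
  octagon_closed (octagon t1 t2 t3 t4 t1' t2' t3' t4') ->
  [&& t1 == t1', t2 == t2', t3 == t3', t4 == t4' & tree_types t1 t2 t3 t4].
Proof.
by case: t1; case: t2; case: t3; case: t4; case: t1'; case: t2'; case: t3'; case: t4';
  vm_compute.
Qed.

(** * Profiles as sets along a chain *)

Section Interp.

Variables (X : finType) (d : nat -> {set X}).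
Hypothesis d_step : forall j, j < 6 -> step (d j) (d j.+1).

Definition depth (x : X) := \sum_(j < 7) (x \notin d j).
Definition interp (m : profile) := [set x | nth false m (depth x)].

Lemma depth_lt x : depth x < 8.
Proof.
rewrite ltnS /depth -[X in _ <= X](card_ord 7) -sum1_card leq_sum // => i _.
by case: (_ \in _).
Qed.

Lemma interp_profile_op op m m' :
  interp (profile_op op m m') = [set x | op (x \in interp m) (x \in interp m')].
Proof. by apply/setP => x; rewrite !inE nth_mkseq ?depth_lt. Qed.

Lemma interpU m m' : interp (profileU m m') = interp m :|: interp m'.
Proof. by rewrite interp_profile_op; apply/setP => x; rewrite !inE. Qed.

Lemma interpI m m' : interp (profileI m m') = interp m :&: interp m'.
Proof. by rewrite interp_profile_op; apply/setP => x; rewrite !inE. Qed.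

Lemma interpD m m' : interp (profileD m m') = interp m :\: interp m'.
Proof. by rewrite interp_profile_op; apply/setP => x; rewrite !inE andbC. Qed.

Lemma depth_leq j x : j < 7 -> (depth x <= j) = (x \in d j).
Proof.
have mono i k : i <= k -> k < 7 -> x \in d i -> x \in d k.
  elim: k => [|k IH]; first by rewrite leqn0 => /eqP->.
  rewrite leq_eqVlt => /orP[/eqP->//|ik] k6 /(IH ik (ltnW k6)).
  exact/subsetP/step_sub/d_step.
have sum_lt k : k <= 7 -> \sum_(i < 7) (i < k) = k.
  by rewrite !big_ord_recl big_ord0 /bump /=; do 8?[case: k => [|k] //].
move=> j7; apply/idP/idP => [|xj]; last first.
  rewrite -[leqRHS](sum_lt _ (ltnW j7)); apply: leq_sum => i _.
  by case: ltnP => [_|ji]; [case: (_ \in _) | rewrite (mono j)].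
apply: contraTT => xj; rewrite -ltnNge -[leqLHS](sum_lt _ j7).
apply: leq_sum => i _; case: ltnP => [ij|//].
by rewrite (contra (mono i j ij j7)).
Qed.

Lemma interp_chain j : j < 7 -> interp (profile_chain j) = d j.
Proof.
by move=> j7; apply/setP => x; rewrite inE nth_mkseq ?depth_lt // depth_leq.
Qed.

(** The element added between [d i] and [d i.+1] has depth [i.+1], so every depth from 1 to 6
    occurs. *)
Lemma interp_inj m m' : interp m = interp m' -> profile_eq m m'.
Proof.
move=> e; apply/allP => i; rewrite mem_iota => /andP[]; case: i => // i _ i6.
have [p pi di] := d_step i6.
suff dp : depth p = i.+1 by move/setP/(_ p): e; rewrite !inE dp => ->.
apply/eqP; rewrite eqn_leq depth_leq // di setU11 /=.
by rewrite ltnNge depth_leq ?(negPf pi) //; lia.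
Qed.

End Interp.

(** * The hexagons on four letters *)

Section Octagon.

Variables (n : nat) (X : finType) (D : seq nat -> {set X}).
Hypothesis HD : compatible n D.
Local Notation valid s := (perm_eq s (iota 1 n)).
Local Notation typ := (typ D).

Lemma D_sub (A : seq nat) (x y : nat) (B : seq nat) :
  valid (A ++ x :: y :: B) -> x < y ->
  D (A ++ y :: x :: B) = D (A ++ x :: y :: B) :|: lab D A x y B.
Proof. by move=> v xy; apply/setU_setD/step_sub/(D_step HD). Qed.

(** This is [hexagon] as a recipe: the type and one path from bottom to top determine the two middle
    words of the other path. *)
Lemma hexagon_sets (A B : seq nat) (x y z : nat) :
    valid (A ++ x :: y :: z :: B) -> x < y -> y < z ->
  let E0 := D (A ++ x :: y :: z :: B) in let E1 := D (A ++ y :: x :: z :: B) in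
  let E2 := D (A ++ y :: z :: x :: B) in let E3 := D (A ++ z :: y :: x :: B) in
  D (A ++ x :: z :: y :: B) = E0 :|: (if typ A x y z B then E2 :\: E1 else E3 :\: E2) /\
  D (A ++ z :: x :: y :: B) = D (A ++ x :: z :: y :: B) :|:
    (if typ A x y z B then E3 :\: E2 else E1 :\: E0).
Proof.
move=> v xy yz /=; have xz := ltn_trans xy yz.
have := @D_sub (rcons A x) y z B; rewrite !cat_rcons => /(_ v yz) {1}->.
rewrite (@D_sub A x z (y :: B)) //; last by apply: perm_valid v _; perm_tac.
have := hexagon HD v xy yz; case: ifP => _ [e1 e2 e3].
  by rewrite -e2 -e3 /lab !cat_rcons.
by rewrite -e1 -e3 /lab.
Qed.

Lemma hexagon_sets_rcons (A B : seq nat) (w x y z : nat) :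
    valid (A ++ w :: x :: y :: z :: B) -> x < y -> y < z ->
  let E0 := D (A ++ w :: x :: y :: z :: B) in
  let E1 := D (A ++ w :: y :: x :: z :: B) in
  let E2 := D (A ++ w :: y :: z :: x :: B) in
  let E3 := D (A ++ w :: z :: y :: x :: B) in let t := typ (rcons A w) x y z B in
  D (A ++ w :: x :: z :: y :: B) = E0 :|: (if t then E2 :\: E1 else E3 :\: E2) /\
  D (A ++ w :: z :: x :: y :: B) = D (A ++ w :: x :: z :: y :: B) :|:
    (if t then E3 :\: E2 else E1 :\: E0).
Proof. by have := @hexagon_sets (rcons A w) B x y z; rewrite !cat_rcons. Qed.

Lemma square_sets (A C : seq nat) (x y z t : nat) :
    valid (A ++ x :: y :: z :: t :: C) -> x < y -> z < t ->
  D (A ++ y :: x :: z :: t :: C) = D (A ++ x :: y :: z :: t :: C) :|: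
    (D (A ++ y :: x :: t :: z :: C) :\: D (A ++ x :: y :: t :: z :: C)) /\
  D (A ++ x :: y :: t :: z :: C) = D (A ++ x :: y :: z :: t :: C) :|:
    (D (A ++ y :: x :: t :: z :: C) :\: D (A ++ y :: x :: z :: t :: C)).
Proof.
move=> v xy zt; have [e1 e2] := @square _ _ _ HD A [::] C x y z t v xy zt.
split; first by rewrite D_sub // e1.
have := @D_sub (A ++ [:: x; y]) z t C; rewrite e2 /lab -!catA /=; exact.
Qed.

(** All 24 sets are computed from the chain [ch] in the order of [octagon], each new word closing a
    square or a hexagon. Closure under joins and meets then carries over to the profiles, and
    [octagon_types] applies. *)
Lemma octagon_typ (A B : seq nat) (a b c d : nat) :
    valid (A ++ [:: a, b, c, d & B]) -> a < b -> b < c -> c < d ->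
  [/\ typ A a b c (d :: B) = typ (rcons A d) a b c B,
      typ A a b d (c :: B) = typ (rcons A c) a b d B,
      typ A a c d (b :: B) = typ (rcons A b) a c d B,
      typ A b c d (a :: B) = typ (rcons A a) b c d B &
      tree_types (typ A a b c (d :: B)) (typ (rcons A c) a b d B)
        (typ A a c d (b :: B)) (typ (rcons A a) b c d B)].
Proof.
move=> v ab bc cd; have ac := ltn_trans ab bc; have bd := ltn_trans bc cd.
have ad := ltn_trans ab bd.
have vp u : perm_eq u [:: a; b; c; d] -> valid (A ++ u ++ B).
  move=> pu; apply: perm_valid v _.
  by rewrite perm_cat2l (perm_cat2r B u [:: a; b; c; d]).
pose W := nth [::] [:: [:: a; b; c; d]; [:: b; a; c; d]; [:: b; c; a; d];
  [:: b; c; d; a]; [:: c; b; d; a]; [:: c; d; b; a]; [:: d; c; b; a]].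
pose ch j := D (A ++ W j ++ B).
have ch_step j : j < 6 -> step (ch j) (ch j.+1).
  have st A' B' x y u u' : x < y -> A ++ u ++ B = A' ++ x :: y :: B' ->
      A ++ u' ++ B = A' ++ y :: x :: B' -> perm_eq u [:: a; b; c; d] ->
      step (D (A ++ u ++ B)) (D (A ++ u' ++ B)).
    by move=> xy e -> pu; rewrite e; apply: (D_step HD) => //; rewrite -e vp.
  rewrite /ch; case: j => [|[|[|[|[|[|]]]]]] //= _.
  - by apply: (st A (c :: d :: B) a b [:: a; b; c; d] [:: b; a; c; d]) => //.
  - by apply: (st (rcons A b) (d :: B) a c [:: b; a; c; d] [:: b; c; a; d]);
      rewrite ?cat_rcons //; perm_tac.
  - by apply: (st (A ++ [:: b; c]) B a d [:: b; c; a; d] [:: b; c; d; a]);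
      rewrite -?catA //; perm_tac.
  - by apply: (st A (d :: a :: B) b c [:: b; c; d; a] [:: c; b; d; a]) => //; perm_tac.
  - by apply: (st (rcons A c) (a :: B) b d [:: c; b; d; a] [:: c; d; b; a]);
      rewrite ?cat_rcons //; perm_tac.
  - by apply: (st A (b :: a :: B) c d [:: c; d; b; a] [:: d; c; b; a]) => //; perm_tac.
pose I := interp ch.
have IC j : j < 7 -> I (profile_chain j) = ch j := @interp_chain _ _ ch_step j.
have IS m0 m1 m2 : I (profile_square m0 m1 m2) = I m0 :|: (I m2 :\: I m1).
  by rewrite /I interpU interpD.
have I1 t m0 m1 m2 m3 : I (profile_hex1 t m0 m1 m2 m3) =
    I m0 :|: (if t then I m2 :\: I m1 else I m3 :\: I m2).
  by rewrite /I interpU; case: t; rewrite interpD.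
have I2 t m0 m1 m2 m3 : I (profile_hex2 t m0 m1 m2 m3) =
    I (profile_hex1 t m0 m1 m2 m3) :|: (if t then I m3 :\: I m2 else I m1 :\: I m0).
  by rewrite /I interpU; case: t; rewrite interpD.
set t1 := typ A a b c (d :: B); set t1' := typ (rcons A d) a b c B.
set t2' := typ A a b d (c :: B); set t2 := typ (rcons A c) a b d B.
set t3 := typ A a c d (b :: B); set t3' := typ (rcons A b) a c d B.
set t4' := typ A b c d (a :: B); set t4 := typ (rcons A a) b c d B.
have V Is : perm_eq Is (iota 0 4) -> valid (A ++ map (nth 0 [:: a; b; c; d]) Is ++ B).
  by move=> pI; apply: vp; apply: (perm_map (nth 0 [:: a; b; c; d]) pI).
pose abcd := profile_chain 0.
have Eabcd : D (A ++ [:: a; b; c; d] ++ B) = I abcd by rewrite IC.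
pose bacd := profile_chain 1.
have Ebacd : D (A ++ [:: b; a; c; d] ++ B) = I bacd by rewrite IC.
pose bcad := profile_chain 2.
have Ebcad : D (A ++ [:: b; c; a; d] ++ B) = I bcad by rewrite IC.
pose bcda := profile_chain 3.
have Ebcda : D (A ++ [:: b; c; d; a] ++ B) = I bcda by rewrite IC.
pose cbda := profile_chain 4.
have Ecbda : D (A ++ [:: c; b; d; a] ++ B) = I cbda by rewrite IC.
pose cdba := profile_chain 5.
have Ecdba : D (A ++ [:: c; d; b; a] ++ B) = I cdba by rewrite IC.
pose dcba := profile_chain 6.
have Edcba : D (A ++ [:: d; c; b; a] ++ B) = I dcba by rewrite IC.
rewrite /= in Eabcd Ebacd Ebcad Ebcda Ecbda Ecdba Edcba.
pose cbad := profile_square bcad bcda cbda.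
have Ecbad : D (A ++ [:: c, b, a, d & B]) = I cbad.
  have [|//|//|-> _] := @square_sets A B b c a d;
    first exact: (V [:: 1; 2; 0; 3] isT).
  by rewrite /cbad IS Ebcad Ebcda Ecbda.
pose acbd := profile_hex1 t1 abcd bacd bcad cbad.
pose cabd := profile_hex2 t1 abcd bacd bcad cbad.
have [Eacbd Ecabd] : D (A ++ [:: a, c, b, d & B]) = I acbd /\
    D (A ++ [:: c, a, b, d & B]) = I cabd.
  have [|//|//|e1 e2] := @hexagon_sets A (d :: B) a b c;
    first exact: (V [:: 0; 1; 2; 3] isT).
  by rewrite e2 e1 /acbd /cabd I2 I1 -/t1 Eabcd Ebacd Ebcad Ecbad.
pose cadb := profile_hex1 t2 cabd cbad cbda cdba.
pose cdab := profile_hex2 t2 cabd cbad cbda cdba.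
have [Ecadb Ecdab] : D (A ++ [:: c, a, d, b & B]) = I cadb /\
    D (A ++ [:: c, d, a, b & B]) = I cdab.
  have [|//|//|e1 e2] := @hexagon_sets_rcons A B c a b d;
    first exact: (V [:: 2; 0; 1; 3] isT).
  by rewrite e2 e1 /cadb /cdab I2 I1 -/t2 Ecabd Ecbad Ecbda Ecdba.
pose acdb := profile_square acbd cabd cadb.
have Eacdb : D (A ++ [:: a, c, d, b & B]) = I acdb.
  have [|//|//|_ ->] := @square_sets A B a c b d;
    first exact: (V [:: 0; 2; 1; 3] isT).
  by rewrite /acdb IS Eacbd Ecabd Ecadb.
pose dcab := profile_square cdab cdba dcba.
have Edcab : D (A ++ [:: d, c, a, b & B]) = I dcab.
  have [|//|//|-> _] := @square_sets A B c d a b;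
    first exact: (V [:: 2; 3; 0; 1] isT).
  by rewrite /dcab IS Ecdab Ecdba Edcba.
pose adcb := profile_hex1 t3 acdb cadb cdab dcab.
pose dacb := profile_hex2 t3 acdb cadb cdab dcab.
have [Eadcb Edacb] : D (A ++ [:: a, d, c, b & B]) = I adcb /\
    D (A ++ [:: d, a, c, b & B]) = I dacb.
  have [|//|//|e1 e2] := @hexagon_sets A (b :: B) a c d;
    first exact: (V [:: 0; 2; 3; 1] isT).
  by rewrite e2 e1 /adcb /dacb I2 I1 -/t3 Eacdb Ecadb Ecdab Edcab.
pose abdc := profile_hex1 t4 abcd acbd acdb adcb.
pose adbc := profile_hex2 t4 abcd acbd acdb adcb.
have [Eabdc Eadbc] : D (A ++ [:: a, b, d, c & B]) = I abdc /\
    D (A ++ [:: a, d, b, c & B]) = I adbc.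
  have [|//|//|e1 e2] := @hexagon_sets_rcons A B a b c d;
    first exact: (V [:: 0; 1; 2; 3] isT).
  by rewrite e2 e1 /abdc /adbc I2 I1 -/t4 Eabcd Eacbd Eacdb Eadcb.
pose bdca := profile_hex1 t4' bcda cbda cdba dcba.
pose dbca := profile_hex2 t4' bcda cbda cdba dcba.
have [Ebdca Edbca] : D (A ++ [:: b, d, c, a & B]) = I bdca /\
    D (A ++ [:: d, b, c, a & B]) = I dbca.
  have [|//|//|e1 e2] := @hexagon_sets A (a :: B) b c d;
    first exact: (V [:: 1; 2; 3; 0] isT).
  by rewrite e2 e1 /bdca /dbca I2 I1 -/t4' Ebcda Ecbda Ecdba Edcba.
pose badc := profile_hex1 t3' bacd bcad bcda bdca.
pose bdac := profile_hex2 t3' bacd bcad bcda bdca.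
have [Ebadc Ebdac] : D (A ++ [:: b, a, d, c & B]) = I badc /\
    D (A ++ [:: b, d, a, c & B]) = I bdac.
  have [|//|//|e1 e2] := @hexagon_sets_rcons A B b a c d;
    first exact: (V [:: 1; 0; 2; 3] isT).
  by rewrite e2 e1 /badc /bdac I2 I1 -/t3' Ebacd Ebcad Ebcda Ebdca.
(* The second half of the octagon reaches [abdc] again; primed profiles belong to words computed
   before. *)
pose abdc' := profile_square abcd bacd badc.
have Eabdc' : D (A ++ [:: a, b, d, c & B]) = I abdc'.
  have [|//|//|_ ->] := @square_sets A B a b c d;
    first exact: (V [:: 0; 1; 2; 3] isT).
  by rewrite /abdc' IS Eabcd Ebacd Ebadc.
pose dbac := profile_square bdac bdca dbca.
have Edbac : D (A ++ [:: d, b, a, c & B]) = I dbac.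
  have [|//|//|-> _] := @square_sets A B b d a c;
    first exact: (V [:: 1; 3; 0; 2] isT).
  by rewrite /dbac IS Ebdac Ebdca Edbca.
pose adbc' := profile_hex1 t2' abdc badc bdac dbac.
pose dabc := profile_hex2 t2' abdc badc bdac dbac.
have [Eadbc' Edabc] : D (A ++ [:: a, d, b, c & B]) = I adbc' /\
    D (A ++ [:: d, a, b, c & B]) = I dabc.
  have [|//|//|e1 e2] := @hexagon_sets A (c :: B) a b d;
    first exact: (V [:: 0; 1; 3; 2] isT).
  by rewrite e2 e1 /adbc' /dabc I2 I1 -/t2' Eabdc Ebadc Ebdac Edbac.
pose dacb' := profile_hex1 t1' dabc dbac dbca dcba.
pose dcab' := profile_hex2 t1' dabc dbac dbca dcba.
have [Edacb' Edcab'] : D (A ++ [:: d, a, c, b & B]) = I dacb' /\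
    D (A ++ [:: d, c, a, b & B]) = I dcab'.
  have [|//|//|e1 e2] := @hexagon_sets_rcons A B d a b c;
    first exact: (V [:: 3; 0; 1; 2] isT).
  by rewrite e2 e1 /dacb' /dcab' I2 I1 -/t1' Edabc Edbac Edbca Edcba.
pose adcb' := profile_square adbc dabc dacb.
have Eadcb' : D (A ++ [:: a, d, c, b & B]) = I adcb'.
  have [|//|//|_ ->] := @square_sets A B a d b c;
    first exact: (V [:: 0; 3; 1; 2] isT).
  by rewrite /adcb' IS Eadbc Edabc Edacb.
pose o := octagon t1 t2 t3 t4 t1' t2' t3' t4'.
have oE : all (fun e => D (A ++ map (nth 0 [:: a; b; c; d]) e.1 ++ B) == I e.2) o.
  rewrite /o /octagon -/abcd -/bacd -/bcad -/bcda -/cbda -/cdba -/dcba.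
  rewrite -/cbad -/acbd -/cabd -/cadb -/cdab -/acdb -/dcab -/adcb -/dacb -/abdc -/adbc.
  rewrite -/bdca -/dbca -/badc -/bdac -/abdc' -/dbac -/adbc' -/dabc -/dacb' -/dcab'.
  rewrite -/adcb' /all !cat_cons cat0s.
  rewrite Eabcd Ebacd Ebcad Ebcda Ecbda Ecdba Edcba Ecbad Eacbd Ecabd Ecadb Ecdab.
  rewrite Eacdb Eadcb Edacb Eabdc Eadbc Ebdca Edbca Ebadc.
  rewrite Edcab Ebdac Edbac Edabc !eqxx.
  (* The five words listed twice are turned back into values of [D], then evaluated by their second
     profiles. *)
  rewrite -Eabdc -Eadbc -Edacb -Edcab -Eadcb.
  by rewrite Eabdc' Eadbc' Edacb' Edcab' Eadcb' !eqxx.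
have operm : all (fun e => perm_eq e.1 (iota 0 4)) o by [].
(* All 24 rearrangements are listed, so whichever word [D_join] or [D_meet] produces has a profile
   in [o]. *)
have ofull : all (fun p => p \in map fst o) (permutations (iota 0 4)) by [].
have closed : octagon_closed o.
  have pW e : e \in o -> perm_eq [:: a; b; c; d] (map (nth 0 [:: a; b; c; d]) e.1).
    move/(allP operm) => pe; rewrite perm_sym.
    exact: (perm_map (nth 0 [:: a; b; c; d]) pe).
  have found E : (exists2 z, perm_eq [:: a; b; c; d] z & D (A ++ z ++ B) = I E) ->
      has (fun e => profile_eq e.2 E) o.
    case=> z /perm_eq_nth[Is /(allP ofull)/mapP[e eo ->] ->] De; apply/hasP; exists e => //.
    by apply: (interp_inj ch_step); rewrite -[RHS]De (eqP (allP oE _ eo)).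
  rewrite /octagon_closed; case: ifPn => [_|/negP[]].
    apply/allP => e eo; apply/allP => e' eo'; apply/andP; split; apply: found.
      have [z pz Dz] :=
        @D_join _ _ _ HD A [:: a; b; c; d] _ _ B v (pW _ eo) (pW _ eo'); exists z => //.
      by rewrite [LHS]Dz (eqP (allP oE _ eo)) (eqP (allP oE _ eo')) -interpU.
    have [z pz Dz] :=
        @D_meet _ _ _ HD A [:: a; b; c; d] _ _ B v (pW _ eo) (pW _ eo'); exists z => //.
    by rewrite [LHS]Dz (eqP (allP oE _ eo)) (eqP (allP oE _ eo')) -interpI.
  apply/allP => e eo; apply/allP => e' eo'; apply/implyP => /eqP ee'.
  apply: (interp_inj ch_step).
  by rewrite -[LHS](eqP (allP oE _ eo)) -[RHS](eqP (allP oE _ eo')) ee'.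
by have /and5P[/eqP ? /eqP ? /eqP ? /eqP ? ?] := octagon_types closed.
Qed.
End Octagon.

(** * Types of triples and the tree *)

(** The tails are matched first, by induction with the first letter held fixed; then [x] travels
    through [t1] to its place. *)
Lemma perm_adjacent_swaps (T : eqType) (R : Type) (f : seq T -> R) (s t : seq T) :
    perm_eq s t ->
    (forall A x y B, perm_eq (A ++ x :: y :: B) s ->
       f (A ++ x :: y :: B) = f (A ++ y :: x :: B)) ->
  f s = f t.
Proof.
elim: s f t => [|x s IH] f t; first by rewrite perm_sym => /perm_nilP ->.
move=> st fE; have xt : x \in t by rewrite -(perm_mem st) inE eqxx.
case/splitPr: xt st => t1 t2 st.
have st12 : perm_eq s (t1 ++ t2).
  by move: st; rewrite perm_sym -cat1s perm_catCA perm_cons perm_sym.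
rewrite (IH (fun u => f (x :: u)) (t1 ++ t2)) //; last first.
  by move=> A y z B pA; apply: (fE (x :: A)); rewrite /= perm_cons.
have {st12} : perm_eq (t1 ++ x :: t2) (x :: s) by rewrite perm_sym.
elim/last_ind: t1 t2 {st} => [//|t1 y IHt] t2; rewrite !cat_rcons => pt.
rewrite (fE t1 y x t2) // (IHt (y :: t2)) //; apply: perm_trans pt.
by rewrite perm_cat2l -(cat1s x) -(cat1s y) perm_catCA.
Qed.

Section TripleTypes.

Variables (n : nat) (X : finType) (D : seq nat -> {set X}).
Hypothesis HD : compatible n D.
Local Notation valid s := (perm_eq s (iota 1 n)).
Local Notation typ := (typ D).
Local Notation lab := (lab D).

Lemma valid_uniq (s : seq nat) : valid s -> uniq s.
Proof. by move=> v; rewrite (perm_uniq v) iota_uniq. Qed.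

Lemma lab_swap_l (A B C : seq nat) (x y z t : nat) :
    valid (A ++ z :: t :: B ++ x :: y :: C) -> x < y ->
  lab (A ++ z :: t :: B) x y C = lab (A ++ t :: z :: B) x y C.
Proof.
move=> v xy; have zt : z != t.
  have := valid_uniq v; rewrite cat_uniq /= => /and3P[_ _ /andP[]].
  by rewrite inE negb_or => /andP[].
have [ltzt|lttz] : z < t \/ t < z by lia.
  by have [_ ->] := square HD v ltzt xy.
by have [|//|//|_ <-] := @square _ _ _ HD A B C t z x y; first by apply: perm_valid v _; perm_tac.
Qed.

Lemma lab_swap_r (A B C : seq nat) (x y z t : nat) :
    valid (A ++ x :: y :: B ++ z :: t :: C) -> x < y ->
  lab A x y (B ++ z :: t :: C) = lab A x y (B ++ t :: z :: C).
Proof.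
move=> v xy; have zt : z != t.
  have := valid_uniq v; rewrite -!cat_cons catA cat_uniq /= => /and3P[_ _ /andP[]].
  by rewrite inE negb_or => /andP[].
have [ltzt|lttz] : z < t \/ t < z by lia.
  by have [-> _] := square HD v xy ltzt.
by have [|//|//|<- _] := @square _ _ _ HD A B C x y t z; first by apply: perm_valid v _; perm_tac.
Qed.

(** Swaps inside [A] or [B] commute with that of [x] and [y], so each of them closes a square. *)
Lemma lab_perm (A A' B B' : seq nat) (x y : nat) :
    valid (A ++ x :: y :: B) -> x < y -> perm_eq A A' -> perm_eq B B' ->
  lab A x y B = lab A' x y B'.
Proof.
move=> v xy pA pB; transitivity (lab A' x y B).
  apply: (perm_adjacent_swaps (f := fun A => lab A x y B) pA) => A1 z t A2 pA1.
  apply: lab_swap_l => //; apply: perm_valid v _.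
  by rewrite -!cat_cons catA perm_cat2r.
apply: (perm_adjacent_swaps pB) => B1 z t B2 pB1.
apply: lab_swap_r => //; apply: perm_valid v _.
by apply: perm_cat; [rewrite perm_sym | rewrite !perm_cons].
Qed.

(** In the second type this equality would make the step from [yxz] to [yzx] add an element already
    present. The lemma reduces invariance of types to invariance of labels. *)
Lemma typ_lab (A B : seq nat) (x y z : nat) :
    valid (A ++ x :: y :: z :: B) -> x < y -> y < z ->
  typ A x y z B = (lab A x y (z :: B) == lab (rcons A z) x y B).
Proof.
move=> v xy yz; have := hexagon HD v xy yz.
case: ifP => _ [e1 e2 e3]; first by rewrite e1 eqxx.
apply/esym/negbTE/eqP => e; have [p lp] := step_setD (D_step HD v xy).
have : p \in lab (rcons A y) x z B by rewrite e2 -e [lab _ _ _ _]lp inE.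
have : p \in lab A x y (z :: B) by rewrite [lab _ _ _ _]lp inE.
by rewrite /lab !cat_rcons !inE => /andP[_ ->].
Qed.

Lemma typ_perm (A A' B : seq nat) (x y z : nat) :
    valid (A ++ x :: y :: z :: B) -> x < y -> y < z -> perm_eq A A' ->
  typ A x y z B = typ A' x y z B.
Proof.
move=> v xy yz pA; rewrite !typ_lab //; last first.
  by apply: perm_valid v _; rewrite perm_cat2r perm_sym.
rewrite (lab_perm v xy pA (perm_refl _)); congr (_ == _).
apply: lab_perm; rewrite ?perm_rcons ?perm_cons //; last by rewrite perm_sym perm_rcons perm_cons perm_sym.
by apply: perm_valid v _; perm_tac.
Qed.

(** The four possible ranks of [w] among [x < y < z] correspond to the four equations of
    [octagon_typ]. *)
Lemma typ_move (A B : seq nat) (w x y z : nat) :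
    valid (A ++ w :: x :: y :: z :: B) -> x < y -> y < z ->
  typ (rcons A w) x y z B = typ A x y z (w :: B).
Proof.
move=> v xy yz; have := valid_uniq v; rewrite cat_uniq => /and3P[_ _].
rewrite /= !inE !negb_or => /andP[/and4P[wx wy wz _] _].
have [|xw|wx'] := ltngtP w x; last by rewrite wx' eqxx in wx.
  move=> wx'; have [|//|//|//|_ _ _ -> //] := @octagon_typ _ _ _ HD A B w x y z.
  by apply: perm_valid v _; perm_tac.
have [wy'|yw|wy'] := ltngtP w y; last by rewrite wy' eqxx in wy.
  have [|//|//|//|_ _ -> //] := @octagon_typ _ _ _ HD A B x w y z.
  by apply: perm_valid v _; perm_tac.
have [wz'|zw|wz'] := ltngtP w z; last by rewrite wz' eqxx in wz.
  have [|//|//|//|_ -> //] := @octagon_typ _ _ _ HD A B x y w z.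
  by apply: perm_valid v _; perm_tac.
have [|//|//|//|-> //] := @octagon_typ _ _ _ HD A B x y z w.
by apply: perm_valid v _; perm_tac.
Qed.

(** The remaining letters stand in front in increasing order; by [typ_triple_type] any other
    placement gives the same value when [x < y < z]. *)
Definition triple_type x y z :=
  typ [seq u <- iota 1 n | u \notin [:: x; y; z]] x y z [::].

Lemma typ_triple_type (A B : seq nat) (x y z : nat) :
    valid (A ++ x :: y :: z :: B) -> x < y -> y < z ->
  typ A x y z B = triple_type x y z.
Proof.
move=> v xy yz; have -> : typ A x y z B = typ (A ++ B) x y z [::].
  elim: B A v => [|w B IH] A v; first by rewrite cats0.
  rewrite -typ_move //; last by apply: perm_valid v _; perm_tac.
  by rewrite IH ?cat_rcons //; apply: perm_valid v _; perm_tac.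
apply: typ_perm => //; first by apply: perm_valid v _; perm_tac.
have u := valid_uniq v.
have pAB := perm_filter (fun u => u \notin [:: x; y; z]) v.
apply: perm_trans pAB; rewrite filter_cat /= !inE !eqxx !orbT /=.
rewrite -filter_cat (all_filterP _) //; apply/allP => a aAB; rewrite !inE.
have : uniq (x :: y :: z :: A ++ B).
  by rewrite -(perm_uniq (_ : perm_eq (A ++ x :: y :: z :: B) _)) //; perm_tac.
rewrite /= !inE !negb_or => /and4P[/and3P[_ _ xA] /andP[_ yA] zA _].
by apply/and3P; split; [apply: contraNneq xA | apply: contraNneq yA | apply: contraNneq zA] => <-.
Qed.

Lemma valid_extend (u : seq nat) : uniq u -> {subset u <= iota 1 n} ->
  valid (u ++ [seq a <- iota 1 n | a \notin u]).
Proof.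
move=> uu sub; apply: uniq_perm; rewrite ?iota_uniq //.
  rewrite cat_uniq uu filter_uniq ?iota_uniq // andbT.
  by apply/hasPn => a; rewrite mem_filter => /andP[].
by move=> a; rewrite mem_cat mem_filter; case: (boolP (a \in u)) => [/sub ->|].
Qed.

Lemma triple_type_tree_types a b c d : 0 < a -> a < b -> b < c -> c < d -> d <= n ->
  tree_types (triple_type a b c) (triple_type a b d) (triple_type a c d) (triple_type b c d).
Proof.
move=> a0 ab bc cd dn.
have v : valid ([:: a; b; c; d] ++ [seq e <- iota 1 n | e \notin [:: a; b; c; d]]).
  apply: valid_extend; first by rewrite /= !inE; lia.
  by move=> e; rewrite !inE mem_iota; lia.
have [_ _ _ _] := @octagon_typ _ _ _ HD [::] _ a b c d v ab bc cd.
set B := filter _ _ in v *.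
have ac := ltn_trans ab bc; have bd := ltn_trans bc cd.
rewrite !typ_triple_type //; by apply: perm_valid v _; perm_tac.
Qed.

End TripleTypes.

Lemma count_iota_decr (p : pred nat) m k :
    (forall a b, m <= a -> a < b -> b < m + k -> p b -> p a) ->
  forall b, m <= b < m + k -> p b = (b < m + count p (iota m k)).
Proof.
elim: k m => [|k IH] m decr b /andP[mb bk]; first lia.
rewrite /=; case pm: (p m) => /=.
  have [->|bm] := eqVneq b m; first by rewrite pm; lia.
  rewrite (IH m.+1) ?addSn; first by lia.
    by move=> a c ma ac ck; apply: decr; lia.
  by lia.
have np a : m <= a -> a < m + k.+1 -> p a = false.
  rewrite leq_eqVlt => /orP[/eqP<-//|ma] ak.
  by apply/negbTE/negP => /(decr m a (leqnn m) ma ak); rewrite pm.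
rewrite np // add0n (eq_in_count (a2 := pred0)) ?count_pred0; first by lia.
by move=> a; rewrite mem_iota => /andP[ma ak]; apply: np; lia.
Qed.

(** * Cuts and the binary tree they define *)

Section Cut.

Variables (n : nat) (ch : nat -> nat -> nat -> bool).
Hypothesis ch_types : forall a b c d, 0 < a -> a < b -> b < c -> c < d -> d <= n ->
  tree_types (ch a b c) (ch a b d) (ch a c d) (ch b c d).

(* The last b such that ch a b c holds, or a if there is none: the count yields it
   because ch a b c decreases in b. *)
Definition cut a c := a + count (fun b => ch a b c) (iota a.+1 (c - a.+1)).

Lemma cut_bounds a c : a < c -> a <= cut a c < c.
Proof.
move=> ac; rewrite /cut leq_addr /=.
by have := count_size (fun b => ch a b c) (iota a.+1 (c - a.+1)); rewrite size_iota; lia.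
Qed.

(** The condition [tree_types] forbids [ch a b2 c] without [ch a b1 c] when [b1 < b2], so the [b]
    with [ch a b c] form an initial segment. *)
Lemma cutE a b c : 0 < a -> a < b -> b < c -> c <= n -> ch a b c = (b <= cut a c).
Proof.
move=> a0 ab bc cn.
rewrite (@count_iota_decr (fun b => ch a b c) a.+1 (c - a.+1)) /cut; [lia| |lia].
move=> b1 b2 ab1 b12 b2c; have {}b2c : b2 < c by lia.
have := ch_types a0 ab1 b12 b2c cn.
by rewrite /tree_types; case: (ch a b1 c) => //; case: (ch a b2 c); rewrite ?andbF.
Qed.

Lemma cut_unique a c k : 0 < a -> c <= n -> a <= k < c ->
  (forall b, a < b -> b < c -> ch a b c = (b <= k)) -> cut a c = k.
Proof.
move=> a0 cn /andP[ak kc] chE; have /andP[acut cutc] := cut_bounds (leq_ltn_trans ak kc).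
have [kcut|cutk|//] := ltngtP k (cut a c).
  by have := chE (cut a c); rewrite cutE //; lia.
by have := chE k; rewrite cutE //; lia.
Qed.

(** A cut persists in every subinterval that still straddles it, which is why all cuts come from one
    tree. The right end is moved first, then the left, using [tree_types] on one quadruple for each
    middle letter [b]. *)
Lemma cut_sub a a' c' c : 0 < a -> a <= a' -> a' <= cut a c -> cut a c < c' ->
  c' <= c -> c <= n -> cut a' c' = cut a c.
Proof.
move=> a0 aa' a'k kc' c'c cn; set k := cut a c in a'k kc' *.
have ackc' : cut a c' = k.
  have [->//|nc] := eqVneq c' c; have {nc}c'c : c' < c by lia.
  apply: cut_unique => [//||//|b ab bc']; [lia|lia|].
  have := ch_types a0 ab bc' c'c cn; rewrite [ch a b c]cutE ?[ch a c' c]cutE -?/k //; try lia.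
  by rewrite /tree_types [c' <= k]leqNgt kc'; case: (b <= k); case: (ch a b c').
have [<-//|na] := eqVneq a a'; have {na}aa' : a < a' by lia.
apply: cut_unique => [|||b a'b bc']; [lia|lia|lia|].
have := ch_types a0 aa' a'b bc'.
rewrite [ch a a' c']cutE ?[ch a b c']cutE ?ackc' ?a'k; try lia.
rewrite /tree_types; case: (b <= k) => /= h; first by rewrite h //; lia.
by have /andP[_ /negbTE] := h (leq_trans c'c cn).

Qed.

(** The letters [lo] to [hi] have the nodes [lo] to [hi - 1], node [k] separating [k] from [k.+1].
    The fuel [f] suffices once it is at least [hi - lo]. *)
Fixpoint cut_tree f lo hi :=
  if f is f'.+1 then
    if lo < hi then
      Node (cut_tree f' lo (cut lo hi)) (cut lo hi) (cut_tree f' (cut lo hi).+1 hi)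
    else Leaf
  else Leaf.

Lemma inorder_cut_tree f lo hi : hi - lo <= f -> inorder (cut_tree f lo hi) = iota lo (hi - lo).
Proof.
elim: f lo hi => [|f IH] lo hi lohi /=; first by rewrite (_ : hi - lo = 0); [|lia].
case: ltnP => lh /=; last by rewrite (_ : hi - lo = 0); [|lia].
have /andP[lc ch_] := cut_bounds lh; rewrite !IH; [|lia|lia].
have -> : hi - lo = (cut lo hi - lo) + (hi - (cut lo hi).+1).+1 by lia.
by rewrite iotaD /= subnKC.
Qed.

Lemma preorder_cut_tree f lo hi x : x \in preorder (cut_tree f lo hi) -> lo <= x < hi.
Proof.
elim: f lo hi => [|f IH] lo hi //=; case: ltnP => // lh.
have /andP[lc ch_] := cut_bounds lh.
by rewrite inE mem_cat => /or3P[/eqP->|/IH|/IH]; lia.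
Qed.

(** If the root separates [i] from [j], it is [cut i j] by [cut_sub]. Otherwise both letters lie on
    one side of it, and the other subtree has no node between them. *)
Lemma head_cut_tree f lo hi i j d :
    hi - lo <= f -> 0 < lo -> lo <= i -> i < j -> j <= hi -> hi <= n ->
  head d [seq l <- preorder (cut_tree f lo hi) | i <= l < j] = cut i j.
Proof.
elim: f lo hi => [|f IH] lo hi hf lo0 loi ij jhi hin /=; first lia.
have lh : lo < hi by lia.
rewrite lh /=; have /andP[lc ch_] := cut_bounds lh.
case: ifP => [/andP[ic cj]|icj] /=; first by rewrite (cut_sub lo0 loi ic cj).
rewrite filter_cat; have none (s : seq nat) : (forall x, x \in s -> ~~ (i <= x < j)) ->
    [seq l <- s | i <= l < j] = [::].
  by move=> sx; apply/eqP; rewrite -(negbK (_ == _)) -has_filter; apply/hasPn.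
have [jc|cj] := leqP j (cut lo hi).
  rewrite [X in _ ++ X]none ?cats0; first by apply: IH => //; lia.
  by move=> x /preorder_cut_tree; lia.
rewrite none ?cat0s; first by apply: IH => //; lia.
by move=> x /preorder_cut_tree; lia.
Qed.

Lemma mem_R_cut_tree i j k : 0 < i -> i <= k -> k < j -> j <= n ->
  ((i, j) \in R_ n (cut_tree n 1 n) k) = (cut i j == k).
Proof.
move=> i0 ik kj jn; rewrite mem_filter mem_P /P_le /= i0 (leq_ltn_trans ik kj) jn ik kj /= andbT.
(* The default value [k] makes the empty list agree with the vacuous condition in [R_], as the
   induction on the list requires. *)
rewrite -(@head_cut_tree n 1 n i j k) //; [|lia|lia].
have pk : (i <= k) && (k < j) by rewrite ik.
elim: (preorder _) => /= [|a u IHu]; first by rewrite eqxx.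
have [->|ak] := eqVneq a k; first by rewrite pk /= eqxx.
by rewrite /=; case: ifP => /= _; rewrite ?IHu ?(negPf ak).
Qed.

(** The pairs with cut [k] fill the whole rectangle below the maximum of [R_ n t k]: one inclusion
    is maximality, the other is [cut_sub]. *)
Lemma cut_tree_intervals k (t := cut_tree n 1 n) : 0 < k < n ->
  [/\ 0 < i_ n t k, i_ n t k <= k, k < j_ n t k, j_ n t k <= n &
    forall i j, 0 < i -> i < j -> j <= n ->
      (cut i j == k) = [&& i_ n t k <= i, i <= k, k < j & j <= j_ n t k]].
Proof.
move=> kn; have [mR mmax] := maximumP t kn; rewrite /i_ /j_.
case: (maximum _) mR mmax => I J /= mR mmax.
have := mR; rewrite mem_filter mem_P /P_le /= => /andP[/andP[/andP[Ik kJ] _]].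
case/andP=> /andP[I0 IJ] Jn; split=> // i j i0 ij jn.
have cutIJ : cut I J = k by apply/eqP; rewrite -mem_R_cut_tree.
apply/eqP/and4P => [e|[Ii ik kj jJ]]; last by rewrite -cutIJ; apply: cut_sub; rewrite ?cutIJ.
have := cut_bounds ij; rewrite e => /andP[ik kj].
have : (i, j) \in R_ n t k by rewrite mem_R_cut_tree // e.
by move/mmax; rewrite /P_le /= => /andP[].
Qed.

Lemma cut_tree_T : 0 < n -> cut_tree n 1 n \in T_ n.-1.
Proof. by move=> n0; rewrite inE inorder_cut_tree ?subn1 // leq_pred. Qed.

End Cut.

(** * The index set of the tree order *)

Section Shuffle.

Variables (L R : pred nat).
Hypothesis LR : forall a, L a -> R a = false.

(* The q-th R-letter occurs before the p-th L-letter, both counted from 0. *)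
Fixpoint shuffled (s : seq nat) p q :=
  if s is a :: s' then
    if L a then if p is p'.+1 then shuffled s' p' q else false
    else if R a then if q is q'.+1 then shuffled s' p q' else true
    else shuffled s' p q
  else false.

Lemma before_cons (s : seq nat) a x y : x != a -> y != a ->
  before (a :: s) x y = before s x y.
Proof. by rewrite /before /= eq_sym => /negPf->; rewrite eq_sym => /negPf->. Qed.

Lemma before_shuffled (s : seq nat) p q : uniq s -> p < count L s -> q < count R s ->
  before s (nth 0 (filter R s) q) (nth 0 (filter L s) p) = shuffled s p q.
Proof.
elim: s p q => //= a s IH p q /andP[as_ us].
have mL p' : p' < count L s -> nth 0 (filter L s) p' != a.
  move=> p's; apply: contraNneq as_ => <-.
  by have := mem_nth 0 (_ : p' < size (filter L s)); rewrite size_filter mem_filter => /(_ p's)/andP[].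
have mR p' : p' < count R s -> nth 0 (filter R s) p' != a.
  move=> p's; apply: contraNneq as_ => <-.
  by have := mem_nth 0 (_ : p' < size (filter R s)); rewrite size_filter mem_filter => /(_ p's)/andP[].
case La: (L a) => /=.
  rewrite LR //=; case: p => [|p] ps qs /=; first by rewrite /before /= eqxx.
  by rewrite before_cons ?IH // ?mL ?mR.
case Ra: (R a) => /=; last by move=> ps qs; rewrite before_cons ?IH // ?mL ?mR.
case: q => [|q] ps qs /=; last by rewrite before_cons ?IH // ?mL ?mR.
by rewrite /before /= eqxx eq_sym (negPf (mL _ ps)).
Qed.

(** A new entry arises only when an L-letter [x] is passed by an R-letter [y], at the ranks counted
    in [A]. The hypothesis excludes the swap that would remove an entry. *)
Lemma shuffled_swap (A B : seq nat) x y p q : ~~ (R x && L y) ->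
  shuffled (A ++ y :: x :: B) p q =
  shuffled (A ++ x :: y :: B) p q || [&& L x, R y, p == count L A & q == count R A].
Proof.
move=> RxLy; elim: A p q => [|a A IH] p q /=.
  case Lx: (L x); case Ly: (L y) => /=.
  - by rewrite (LR Ly) orbF; case: p => [|[|p]].
  - by case: (R y); rewrite ?orbF //; case: p => [|p]; case: q => [|q]; rewrite ?orbF.
  - by move: RxLy; rewrite Ly andbT => /negPf->; rewrite orbF.
  - by rewrite orbF; case: (R x); case: (R y); case: q => [|[|q]].
case La: (L a) => /=.
  rewrite (LR La) //=; case: p => [|p]; last by rewrite IH.
  by case: (L x); case: (R y).
case: (R a) => /=; last by rewrite IH.
by case: q => [|q] //; rewrite IH.
Qed.

Lemma shuffled_none (s1 s2 : seq nat) p q :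
  {in s1, forall a, R a = false} -> p < count L s1 -> shuffled (s1 ++ s2) p q = false.
Proof.
elim: s1 p => //= a s1 IH p nR; rewrite nR ?mem_head //.
have IH' p' : p' < count L s1 -> shuffled (s1 ++ s2) p' q = false.
  by apply: IH => b bs; apply: nR; rewrite inE bs orbT.
by case: (L a) => //=; [case: p => // p; apply: IH' | apply: IH'].
Qed.

Lemma shuffled_all (s1 s2 : seq nat) p q :
  {in s1, forall a, L a = false} -> q < count R s1 -> shuffled (s1 ++ s2) p q.
Proof.
elim: s1 q => //= a s1 IH q nL; rewrite nL ?mem_head //.
have IH' q' : q' < count R s1 -> shuffled (s1 ++ s2) p q'.
  by apply: IH => b bs; apply: nL; rewrite inE bs orbT.
by case: (R a) => //=; [case: q => // q; apply: IH' | apply: IH'].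
Qed.

End Shuffle.

Lemma count_interval a b m l : m <= a -> a <= b -> b < m + l ->
  count (fun z => a <= z <= b) (iota m l) = (b - a).+1.
Proof.
move=> ma ab bl; have -> : l = (a - m) + ((b - a).+1 + (m + l - b.+1)) by lia.
rewrite !iotaD !count_cat subnKC // (_ : a + (b - a).+1 = b.+1); last by lia.
rewrite (eq_in_count (a2 := pred0)) ?count_pred0; last first.
  by move=> z; rewrite mem_iota /=; lia.
rewrite (eq_in_count (a2 := predT)) ?count_predT ?size_iota; last first.
  by move=> z; rewrite mem_iota /=; lia.
rewrite (eq_in_count (a2 := pred0)) ?count_pred0 ?addn0 //.
by move=> z; rewrite mem_iota /=; lia.
Qed.

(** * Labels and the tree order *)

Section Labels.

Variables (n : nat) (X : finType) (D : seq nat -> {set X}).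
Hypothesis HD : compatible n D.
Local Notation valid s := (perm_eq s (iota 1 n)).
Local Notation lab := (lab D).
Local Notation kap := (cut (triple_type n D)).
Local Notation t := (cut_tree (triple_type n D) n 1 n).

Let ch_types := triple_type_tree_types HD.

(** The letters of [wL], those of [wR] and the remaining ones are selected by [inL k], [inR k] and
    [inO k]. *)
Definition inL k z := i_ n t k <= z <= k.
Definition inR k z := k < z <= j_ n t k.
Definition inO k z := ~~ inL k z && ~~ inR k z.

Lemma valid_mem (s : seq nat) z : valid s -> z \in s -> 0 < z <= n.
Proof. by move=> v; rewrite (perm_mem v) mem_iota; lia. Qed.

Lemma typ_cut (A B : seq nat) (x y z : nat) :
    valid (A ++ x :: y :: z :: B) -> x < y -> y < z ->
  typ D A x y z B = (y <= kap x z).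
Proof.
move=> v xy yz; rewrite (typ_triple_type HD) // (cutE ch_types) //.
  by have := valid_mem (z := x) v; rewrite mem_cat inE eqxx orbT => /(_ isT); lia.
by have := valid_mem (z := z) v; rewrite mem_cat !inE eqxx !orbT => /(_ isT); lia.
Qed.

Lemma kapP x y k : 0 < x -> x < y -> y <= n -> 0 < k < n ->
  (kap x y == k) = inL k x && inR k y.
Proof.
move=> x0 xy yn kn; have [_ _ _ _ ->//] := cut_tree_intervals ch_types kn.
by rewrite /inL /inR -!andbA.
Qed.

Lemma kap_bounds x y : x < y -> x <= kap x y < y.
Proof. exact: cut_bounds. Qed.

Lemma inLR_lt k x y : inL k x -> inR k y -> x < y.
Proof. by rewrite /inL /inR; lia. Qed.

Lemma valid_range (A B u : seq nat) z : valid (A ++ u ++ B) -> z \in u -> 0 < z <= n.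
Proof. by move=> v zu; apply: (valid_mem v); rewrite !mem_cat zu orbT. Qed.

(** As [x <= k = kap z y], the hexagon on [z < x < y] has the first type, whose equal sides trade
    [x] for [z]. *)
Lemma hexagon_left (A B : seq nat) (x y z k : nat) : 0 < k < n ->
    valid (A ++ z :: x :: y :: B) -> inL k x -> inL k z -> inR k y -> z < x ->
  lab (rcons A z) x y B = lab (rcons A x) z y B /\
  lab A x y (z :: B) = lab A z y (x :: B).
Proof.
move=> kn v Lx Lz Ry zx; have xy := inLR_lt Lx Ry.
have r w : w \in [:: z; x; y] -> 0 < w <= n := @valid_range A B [:: z; x; y] w v.
have kE : kap z y = k.
  have := r y; have := r z; rewrite !inE !eqxx !orbT => /(_ isT) rz /(_ isT) ry.
  by apply/eqP; rewrite kapP ?Lz //; lia.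
have := hexagon HD v zx xy; rewrite typ_cut // kE.
by have -> : x <= k; [move: Lx; rewrite /inL; lia | case].
Qed.

(** Here [kap x z = k < y] gives the second type. *)
Lemma hexagon_right (A B : seq nat) (x y z k : nat) : 0 < k < n ->
    valid (A ++ x :: y :: z :: B) -> inL k x -> inR k y -> inR k z -> y < z ->
  lab (rcons A z) x y B = lab (rcons A y) x z B /\
  lab A x y (z :: B) = lab A x z (y :: B).
Proof.
move=> kn v Lx Ry Rz yz; have xy := inLR_lt Lx Ry.
have r w : w \in [:: x; y; z] -> 0 < w <= n := @valid_range A B [:: x; y; z] w v.
have kE : kap x z = k.
  have := r x; have := r z; rewrite !inE !eqxx !orbT => /(_ isT) rz /(_ isT) rx.
  by apply/eqP; rewrite kapP ?Lx //; lia.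
have := hexagon HD v xy yz; rewrite typ_cut // kE.
by have -> : (y <= k) = false; [move: Ry; rewrite /inR; lia | case].
Qed.

Lemma lab_left (A B : seq nat) (x y z k : nat) : 0 < k < n ->
    valid (A ++ z :: x :: y :: B) -> inL k x -> inL k z -> inR k y ->
  lab (rcons A z) x y B = lab (rcons A x) z y B /\
  lab A x y (z :: B) = lab A z y (x :: B).
Proof.
move=> kn v Lx Lz Ry.
have := valid_uniq v; rewrite cat_uniq => /and3P[_ _] /=.
rewrite !inE => /andP[/norP[zx _] _].
have [ltzx|ltxz] : z < x \/ x < z by lia.
  exact: hexagon_left kn v Lx Lz Ry ltzx.
have v' : valid (A ++ x :: z :: y :: B) by apply: perm_valid v _; perm_tac.
by have [-> ->] := hexagon_left kn v' Lz Lx Ry ltxz.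
Qed.

Lemma lab_right (A B : seq nat) (x y z k : nat) : 0 < k < n ->
    valid (A ++ x :: y :: z :: B) -> inL k x -> inR k y -> inR k z ->
  lab (rcons A z) x y B = lab (rcons A y) x z B /\
  lab A x y (z :: B) = lab A x z (y :: B).
Proof.
move=> kn v Lx Ry Rz.
have := valid_uniq v; rewrite cat_uniq => /and3P[_ _] /=.
rewrite !inE => /and3P[_ /norP[yz _] _].
have [ltyz|ltzy] : y < z \/ z < y by lia.
  exact: hexagon_right kn v Lx Ry Rz ltyz.
have v' : valid (A ++ x :: z :: y :: B) by apply: perm_valid v _; perm_tac.
by have [-> ->] := hexagon_right kn v' Lx Rz Ry ltzy.
Qed.

(** For [z] below the interval, the first type would give [kap z y = k] by [cut_sub], hence
    [inL k z]; so the second type holds and carries [z] across. Above the interval the two types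
    exchange roles. *)
Lemma lab_outside (A B : seq nat) (x y z k : nat) : 0 < k < n ->
    valid (A ++ z :: x :: y :: B) -> inL k x -> inR k y -> inO k z ->
  lab (rcons A z) x y B = lab A x y (z :: B).
Proof.
move=> kn v Lx Ry Oz; have xy := inLR_lt Lx Ry.
have r w : w \in [:: z; x; y] -> 0 < w <= n := @valid_range A B [:: z; x; y] w v.
have := r x; have := r y; have := r z; rewrite !inE !eqxx !orbT.
move=> /(_ isT) rz /(_ isT) ry /(_ isT) rx {r}.
have kE : kap x y = k by apply/eqP; rewrite kapP ?Lx //; lia.
have [zi|jz] : z < i_ n t k \/ j_ n t k < z.
  by move: Oz Lx Ry; rewrite /inO /inL /inR; lia.
  have zx : z < x by move: Lx; rewrite /inL; lia.
  have := hexagon HD v zx xy; rewrite typ_cut //.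
  case: leqP => [xk|_ [_ _ ->]//].
  have /andP[_ ky] := kap_bounds (ltn_trans zx xy).
  have z0 : 0 < z by lia.
  have yn : y <= n by lia.
  have := cut_sub ch_types z0 (ltnW zx) xk ky (leqnn y) yn.
  by rewrite kE => /esym/eqP; rewrite kapP ?(ltn_trans zx xy) // /inL; lia.
have yz : y < z by move: Ry; rewrite /inR; lia.
have v' : valid (A ++ x :: y :: z :: B) by apply: perm_valid v _; perm_tac.
have := hexagon HD v' xy yz; rewrite typ_cut //.
case: leqP => [_ [->]//|ky].
have /andP[xk _] := kap_bounds (ltn_trans xy yz).
have x0 : 0 < x by lia.
have zn : z <= n by lia.
have := cut_sub ch_types x0 (leqnn x) xk ky (ltnW yz) zn.
by rewrite kE => /esym/eqP; rewrite kapP ?(ltn_trans xy yz) // /inR; lia.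
Qed.

Lemma lab_outsiders (A B Os : seq nat) (x y k : nat) : 0 < k < n ->
    valid (A ++ Os ++ x :: y :: B) -> inL k x -> inR k y -> all (inO k) Os ->
  lab (A ++ Os) x y B = lab A x y (Os ++ B).
Proof.
move=> kn; elim/last_ind: Os B => [|Os z IH] B v Lx Ry; first by rewrite cats0.
rewrite all_rcons => /andP[Oz OO]; rewrite -rcons_cat (lab_outside kn) //; last first.
  by apply: perm_valid v _; perm_tac.
by rewrite IH ?cat_rcons //; apply: perm_valid v _; perm_tac.
Qed.

Lemma take_nth_drop (l : seq nat) p : p < size l ->
  l = take p l ++ nth 0 l p :: drop p.+1 l.
Proof. by move=> pl; rewrite -drop_nth // cat_take_drop. Qed.

Lemma perm_take_drop (l l' : seq nat) p :
    perm_eq l l' -> p < size l -> perm_eq (take p l) (take p l') ->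
    nth 0 l p = nth 0 l' p -> perm_eq (drop p.+1 l) (drop p.+1 l').
Proof.
move=> ll' pl pt en; have pl' : p < size l' by rewrite -(perm_size ll').
apply/seq.permP => q; have := seq.permP ll' q; have := seq.permP pt q.
have := congr1 (count q) (take_nth_drop pl).
by have := congr1 (count q) (take_nth_drop pl'); rewrite -en !count_cat /=; lia.
Qed.

Lemma take_addcat (s s' : seq nat) r : take (size s + r) (s ++ s') = s ++ take r s'.
Proof. by rewrite take_cat ltnNge leq_addr addKn. Qed.

Lemma drop_addcat (s s' : seq nat) r : drop (size s + r) (s ++ s') = drop r s'.
Proof. by rewrite drop_cat ltnNge leq_addr addKn. Qed.

Lemma nth_addcat (s s' : seq nat) r : nth 0 (s ++ s') (size s + r) = nth 0 s' r.
Proof. by rewrite nth_cat ltnNge leq_addr addKn. Qed.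

(** The equations on [p] are shaped for [take_addcat], [nth_addcat] and [drop_addcat]. *)
Variant adjacent_split (l1 : seq nat) a b l2 p : Prop :=
| AdjacentFar of perm_eq (take p (l1 ++ a :: b :: l2)) (take p (l1 ++ b :: a :: l2))
    & nth 0 (l1 ++ a :: b :: l2) p = nth 0 (l1 ++ b :: a :: l2) p
| AdjacentFirst of p = size l1 + 0 & p.+1 = size l1 + 1
| AdjacentSecond of p = size l1 + 1 & p.+1 = size l1 + 2.

Lemma adjacent_splitP l1 a b l2 p : adjacent_split l1 a b l2 p.
Proof.
have [pl1|l1p] := ltnP p (size l1).
  by apply: AdjacentFar; rewrite ?nth_cat ?pl1 // !takel_cat // ltnW.
rewrite -(subnKC l1p); case: (p - size l1) => [|[|r]].
- by apply: AdjacentFirst; rewrite ?addn0 ?addn1.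
- by apply: AdjacentSecond; rewrite ?addn1 ?addn2.
apply: AdjacentFar; rewrite ?nth_addcat ?take_addcat //=.
by rewrite perm_cat2l -(cat1s a) -(cat1s b) perm_catCA.
Qed.

(** Left letters before position [p] stand in front of the swap, later ones behind it. Exchanges in
    [l] away from [p] are covered by [lab_perm], those that touch [p] by [lab_left], so the label
    depends on [p] but not on the order of [l]. *)
Lemma lab_exchange_left (C E l l' : seq nat) (y p k : nat) : 0 < k < n ->
    valid (l ++ y :: C ++ E) -> perm_eq l l' -> p < size l ->
    all (inL k) l -> inR k y ->
  lab (take p l ++ C) (nth 0 l p) y (drop p.+1 l ++ E) =
  lab (take p l' ++ C) (nth 0 l' p) y (drop p.+1 l' ++ E).
Proof.
move=> kn v ll' pl Ll Ry.
pose f l := lab (take p l ++ C) (nth 0 l p) y (drop p.+1 l ++ E).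
apply: (perm_adjacent_swaps (f := f) ll') => l1 a b l2 {l' ll'}; rewrite /f.
set m := l1 ++ a :: b :: l2; set m' := l1 ++ b :: a :: l2 => ml.
have mm' : perm_eq m m' by rewrite /m /m'; perm_tac.
have vm : valid (m ++ y :: C ++ E) by apply: perm_valid v _; rewrite perm_cat2r.
have pm : p < size m by rewrite (perm_size ml).
have Lm z : z \in m -> inL k z by rewrite (perm_mem ml) => /(allP Ll).
have La : inL k a by apply: Lm; rewrite mem_cat !inE eqxx !orbT.
have Lb : inL k b by apply: Lm; rewrite mem_cat !inE eqxx !orbT.
case: (adjacent_splitP l1 a b l2 p) => [pt en|pE pE1|pE pE1].
- rewrite -/m -/m' in pt en; rewrite -en; apply: (lab_perm HD).
  + apply: perm_valid vm _; rewrite {4}(take_nth_drop pm); perm_tac.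
  + exact: inLR_lt (Lm _ (mem_nth 0 pm)) Ry.
  + by rewrite perm_cat2r.
  + by rewrite perm_cat2r perm_take_drop.
- rewrite pE1 pE /m /m' !take_addcat !nth_addcat !drop_addcat /= ?cats0 ?drop0.
  have [|_ //] := @lab_left (l1 ++ C) (l2 ++ E) a y b k kn _ La Lb Ry.
  by apply: perm_valid vm _; rewrite /m; perm_tac.
rewrite pE1 pE /m /m' !take_addcat !nth_addcat !drop_addcat /= ?take0 !cats1 ?drop0.
have vb : valid ((l1 ++ C) ++ a :: b :: y :: l2 ++ E).
  by apply: perm_valid vm _; rewrite /m; perm_tac.
have [e _] := lab_left kn vb Lb La Ry.
transitivity (lab (rcons (l1 ++ C) a) b y (l2 ++ E)).
  apply: (lab_perm HD); rewrite ?(inLR_lt Lb Ry) //; last by perm_tac.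
  by apply: perm_valid vm _; rewrite /m; perm_tac.
rewrite e; apply: (lab_perm HD); rewrite ?(inLR_lt La Ry) //; last by perm_tac.
by apply: perm_valid vm _; rewrite /m; perm_tac.
Qed.

Lemma lab_exchange_right (C E l l' : seq nat) (x p k : nat) : 0 < k < n ->
    valid (l ++ x :: C ++ E) -> perm_eq l l' -> p < size l ->
    all (inR k) l -> inL k x ->
  lab (C ++ take p l) x (nth 0 l p) (drop p.+1 l ++ E) =
  lab (C ++ take p l') x (nth 0 l' p) (drop p.+1 l' ++ E).
Proof.
move=> kn v ll' pl Rl Lx.
pose f l := lab (C ++ take p l) x (nth 0 l p) (drop p.+1 l ++ E).
apply: (perm_adjacent_swaps (f := f) ll') => l1 a b l2 {l' ll'}; rewrite /f.
set m := l1 ++ a :: b :: l2; set m' := l1 ++ b :: a :: l2 => ml.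
have mm' : perm_eq m m' by rewrite /m /m'; perm_tac.
have vm : valid (m ++ x :: C ++ E) by apply: perm_valid v _; rewrite perm_cat2r.
have pm : p < size m by rewrite (perm_size ml).
have Rm z : z \in m -> inR k z by rewrite (perm_mem ml) => /(allP Rl).
have Ra : inR k a by apply: Rm; rewrite mem_cat !inE eqxx !orbT.
have Rb : inR k b by apply: Rm; rewrite mem_cat !inE eqxx !orbT.
case: (adjacent_splitP l1 a b l2 p) => [pt en|pE pE1|pE pE1].
- rewrite -/m -/m' in pt en; rewrite -en; apply: (lab_perm HD).
  + apply: perm_valid vm _; rewrite {4}(take_nth_drop pm); perm_tac.
  + exact: inLR_lt Lx (Rm _ (mem_nth 0 pm)).
  + by rewrite perm_cat2l.
  + by rewrite perm_cat2r perm_take_drop.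
- rewrite pE1 pE /m /m' !take_addcat !nth_addcat !drop_addcat /= ?cats0 ?drop0.
  have [|_ //] := @lab_right (C ++ l1) (l2 ++ E) x a b k kn _ Lx Ra Rb.
  by apply: perm_valid vm _; rewrite /m; perm_tac.
rewrite pE1 pE /m /m' !take_addcat !nth_addcat !drop_addcat /= ?take0 !cats1 ?drop0.
have vb : valid ((C ++ l1) ++ x :: b :: a :: l2 ++ E).
  by apply: perm_valid vm _; rewrite /m; perm_tac.
by have [e _] := lab_right kn vb Lx Rb Ra; rewrite -!rcons_cat e.
Qed.

Lemma split_at (s s' : seq nat) x : [/\ take (size s) (s ++ x :: s') = s,
  nth 0 (s ++ x :: s') (size s) = x & drop (size s).+1 (s ++ x :: s') = s'].
Proof.
split; first exact: take_size_cat.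
  by have /= := nth_addcat s (x :: s') 0; rewrite addn0.
by have /= := drop_addcat s (x :: s') 1; rewrite addn1 drop0.
Qed.

Lemma lab_resplit_left (C E lA lA' lB lB' : seq nat) (x x' y k : nat) : 0 < k < n ->
    valid ((lA ++ x :: lB) ++ y :: C ++ E) ->
    perm_eq (lA ++ x :: lB) (lA' ++ x' :: lB') -> size lA = size lA' ->
    all (inL k) (lA ++ x :: lB) -> inR k y ->
  lab (lA ++ C) x y (lB ++ E) = lab (lA' ++ C) x' y (lB' ++ E).
Proof.
move=> kn v pl sz Ll Ry; have [t1 n1 d1] := split_at lA lB x.
have := split_at lA' lB' x'; rewrite -sz => -[t2 n2 d2].
have := @lab_exchange_left C E _ _ y (size lA) k kn v pl _ Ll Ry.
by rewrite size_cat /= -addSnnS leq_addr t1 n1 d1 t2 n2 d2; apply.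
Qed.

Lemma lab_resplit_right (C E rA rA' rB rB' : seq nat) (x y y' k : nat) : 0 < k < n ->
    valid ((rA ++ y :: rB) ++ x :: C ++ E) ->
    perm_eq (rA ++ y :: rB) (rA' ++ y' :: rB') -> size rA = size rA' ->
    all (inR k) (rA ++ y :: rB) -> inL k x ->
  lab (C ++ rA) x y (rB ++ E) = lab (C ++ rA') x y' (rB' ++ E).
Proof.
move=> kn v pl sz Rl Lx; have [t1 n1 d1] := split_at rA rB y.
have := split_at rA' rB' y'; rewrite -sz => -[t2 n2 d2].
have := @lab_exchange_right C E _ _ x (size rA) k kn v pl _ Rl Lx.
by rewrite size_cat /= -addSnnS leq_addr t1 n1 d1 t2 n2 d2; apply.
Qed.

Lemma perm_sides k (s : seq nat) :
  perm_eq s (filter (inL k) s ++ filter (inR k) s ++ filter (inO k) s).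
Proof.
apply/seq.permP => q; rewrite !count_cat; elim: s => //= a s IH.
have := IH; rewrite /inO; have : inL k a -> inR k a = false.
  by rewrite /inL /inR; lia.
by case: (inL k a) => [/(_ isT)->|_] /=; [|case: (inR k a)] => /=; clear; lia.
Qed.

(** Outsiders in [A] move behind the swap by [lab_outsiders]; the other letters are then grouped by
    side. *)
Lemma lab_sides (A B : seq nat) (x y k : nat) : 0 < k < n ->
    valid (A ++ x :: y :: B) -> inL k x -> inR k y ->
  lab A x y B = lab (filter (inL k) A ++ filter (inR k) A) x y
    (filter (inL k) B ++ filter (inR k) B ++ filter (inO k) (A ++ B)).
Proof.
move=> kn v Lx Ry; have pA := perm_sides k A; have pB := perm_sides k B.
rewrite catA in pA; have xy := inLR_lt Lx Ry.
rewrite (lab_perm HD v xy pA (perm_refl B)) (lab_outsiders kn) ?filter_all //; last first.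
  by apply: perm_valid v _; rewrite !catA perm_cat2r perm_sym -catA catA.
apply: (lab_perm HD) => //.
  apply: perm_valid v _; apply/seq.permP => q; have := seq.permP pA q.
  by rewrite !count_cat /= ?count_cat; clear; lia.
apply/seq.permP => q; have := seq.permP pB q.
by rewrite filter_cat !count_cat; clear; lia.
Qed.

(** In the form given by [lab_sides], the left letters are exchanged first, with the right ones as
    fixed context, and then the right letters. *)
Lemma lab_eq (A B A' B' : seq nat) (x y x' y' k : nat) : 0 < k < n ->
    valid (A ++ x :: y :: B) -> valid (A' ++ x' :: y' :: B') ->
    inL k x -> inR k y -> inL k x' -> inR k y' ->
    count (inL k) A = count (inL k) A' -> count (inR k) A = count (inR k) A' ->
  lab A x y B = lab A' x' y' B'.
Proof.
move=> kn v v' Lx Ry Lx' Ry' cL cR.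
rewrite (lab_sides kn v Lx Ry) (lab_sides kn v' Lx' Ry').
have vv' := perm_trans v (_ : perm_eq _ (A' ++ x' :: y' :: B')).
have {}vv' : perm_eq (A ++ x :: y :: B) (A' ++ x' :: y' :: B').
  by apply: vv'; rewrite perm_sym.
have nLR z : inL k z -> inR k z = false by rewrite /inL /inR; lia.
have nRL z : inR k z -> inL k z = false by rewrite /inL /inR; lia.
have pL := perm_filter (inL k) vv'; have pR := perm_filter (inR k) vv'.
have pO := perm_filter (inO k) vv'.
rewrite !filter_cat /= Lx Lx' !nRL // in pL.
rewrite !filter_cat /= Ry Ry' !nLR // in pR.
rewrite !filter_cat /= /inO Lx Lx' Ry Ry' /= !andbF -/(inO k) -!filter_cat in pO.
have sL : size (filter (inL k) A) = size (filter (inL k) A') by rewrite !size_filter.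
have sR : size (filter (inR k) A) = size (filter (inR k) A') by rewrite !size_filter.
have aL : all (inL k) (filter (inL k) A ++ x :: filter (inL k) B).
  by rewrite all_cat /= Lx !filter_all.
have aR : all (inR k) (filter (inR k) A ++ y :: filter (inR k) B).
  by rewrite all_cat /= Ry !filter_all.
have vS : valid ((filter (inL k) A ++ x :: filter (inL k) B) ++
    (filter (inR k) A ++ y :: filter (inR k) B) ++ filter (inO k) (A ++ B)).
  apply: perm_valid v _; apply/seq.permP => q.
  have := seq.permP (perm_sides k A) q; have := seq.permP (perm_sides k B) q.
  by rewrite filter_cat !count_cat /= ?count_cat; clear; lia.
rewrite (lab_resplit_left kn _ pL sL aL Ry); last first.
  by apply: perm_valid vS _; perm_tac.
set lA := filter (inL k) A' in pL *; set lB := filter (inL k) B' in pL *.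
set O := filter _ (A ++ B) in pO vS *.
set rA := filter (inR k) A in aR sR pR vS *; set rB := filter (inR k) B in aR pR vS *.
have vT : valid ((lA ++ x' :: lB) ++ (rA ++ y :: rB) ++ O).
  by apply: perm_valid vS _; rewrite perm_cat2r perm_sym.
transitivity (lab (lA ++ rA) x' y (rB ++ (lB ++ O))).
  apply: (lab_perm HD); rewrite ?(inLR_lt Lx' Ry) //; last by perm_tac.
  by apply: perm_valid vT _; perm_tac.
rewrite (lab_resplit_right kn _ pR sR aR Lx'); last first.
  by apply: perm_valid vT _; perm_tac.
apply: (lab_perm HD); rewrite ?(inLR_lt Lx' Ry') //.
  apply: perm_valid vT _; apply/seq.permP => q; have := seq.permP pR q.
  by rewrite !count_cat /= ?count_cat; clear; lia.
apply/seq.permP => q; have := seq.permP pO q; rewrite !count_cat; clear; lia.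
Qed.

(** * Indices of swaps and their labels *)

Definition pair_ok i j := 0 < i < j /\ j <= n.

(** The pair is tested only at [kap i j], since by [kapP] no other rectangle contains it; [mem_I]
    compares this with [I_]. *)
Definition inI (s : seq nat) i j :=
  shuffled (inL (kap i j)) (inR (kap i j)) s (i - i_ n t (kap i j)) (j - (kap i j).+1).

Lemma inLR k a : inL k a -> inR k a = false.
Proof. by rewrite /inL /inR; lia. Qed.

Lemma kap_ok i j : pair_ok i j ->
  [/\ 0 < kap i j < n, inL (kap i j) i & inR (kap i j) j].
Proof.
case=> /andP[i0 ij] jn; have := kap_bounds ij; case/andP => ik kj.
have kn : 0 < kap i j < n by lia.
by have := kapP i0 ij jn kn; rewrite eqxx => /esym/andP[].
Qed.

Lemma count_inL k s : 0 < k < n -> valid s -> count (inL k) s = (k - i_ n t k).+1.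
Proof.
move=> kn v; have [I0 Ik _ _ _] := cut_tree_intervals ch_types kn.
by rewrite (seq.permP v) count_interval //; lia.
Qed.

Lemma count_inR k s : 0 < k < n -> valid s -> count (inR k) s = j_ n t k - k.
Proof.
move=> kn v; have [_ _ kJ Jn _] := cut_tree_intervals ch_types kn.
by rewrite (seq.permP v) count_interval //; lia.
Qed.

Lemma mem_I (w : 'S_n) i j : ((i, j) \in I_ t w) = [&& 0 < i < j, j <= n & inI (word w) i j].
Proof.
rewrite mem_filter_P /= andbC -andbA; case ij: (0 < i < j) => //=.
case jn: (j <= n) => //=; have ok : pair_ok i j by [].
have [kn Li Rj] := kap_ok ok; set k := kap i j in kn Li Rj.
have vw := perm_eq_word w.
have beforeE : before (word w) (nth 0 (wR t k w) (j - k.+1)) (nth 0 (wL t k w) (i - i_ n t k))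
    = inI (word w) i j.
  apply: before_shuffled; rewrite ?(valid_uniq vw) ?count_inL ?count_inR //.
  - exact: inLR.
  - by move: Li; rewrite /inL; lia.
  - by move: Rj; rewrite /inR; lia.
rewrite -beforeE; apply/hasP/idP => [[k' k'n /and3P[Li' Rj' bk']]|b].
  suff <- : k' = k by [].
  apply/eqP; rewrite eq_sym /k; case/andP: ij => i0 ij; rewrite (kapP) //.
    by rewrite /inL Li'; exact: Rj'.
  by move: k'n; rewrite mem_iota; lia.
exists k; first by rewrite mem_iota; lia.
by move: Li Rj; rewrite /inL /inR => -> ->.
Qed.

(** The pair that the swap of [x] and [y] adds to the index set, by [inI_edge]. *)
Definition edge_index (A : seq nat) x y :=
  (i_ n t (kap x y) + count (inL (kap x y)) A, (kap x y).+1 + count (inR (kap x y)) A).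

Lemma edge_indexP (A B : seq nat) x y : valid (A ++ x :: y :: B) -> x < y ->
  [/\ pair_ok x y, pair_ok (edge_index A x y).1 (edge_index A x y).2 &
      kap (edge_index A x y).1 (edge_index A x y).2 = kap x y].
Proof.
move=> v xy /=; have x0 : 0 < x <= n by apply: (valid_mem v); rewrite mem_cat inE eqxx orbT.
have yn : 0 < y <= n by apply: (valid_mem v); rewrite mem_cat !inE eqxx !orbT.
have ok : pair_ok x y by split; lia.
have [kn Lx Ry] := kap_ok ok; set k := kap x y in kn Lx Ry *.
have [I0 Ik kJ Jn _] := cut_tree_intervals ch_types kn.
have cL := count_inL kn v; have cR := count_inR kn v.
rewrite count_cat /= Lx in cL; rewrite count_cat /= Ry in cR.
have ok' : pair_ok (i_ n t k + count (inL k) A) (k.+1 + count (inR k) A) by split; lia.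
split=> //; apply/eqP; case: ok' => /andP[i0 ij] jn; rewrite (kapP) //.
move: cL cR {i0 ij jn}; move: (count (inL k) A) (count (inR k) A) => cA cB cL cR.
by rewrite /inL /inR; lia.
Qed.

Lemma inI_edge (A B : seq nat) x y i j :
    valid (A ++ x :: y :: B) -> x < y -> pair_ok i j ->
  inI (A ++ y :: x :: B) i j = inI (A ++ x :: y :: B) i j || ((i, j) == edge_index A x y).
Proof.
move=> v xy ok; have [kn Li Rj] := kap_ok ok; rewrite /inI.
rewrite (shuffled_swap (@inLR _)); last by rewrite /inL /inR; lia.
congr (_ || _); have := edge_indexP v xy; rewrite /edge_index /=.
set k' := kap x y; set k := kap i j in kn Li Rj *; case=> okxy ok' kE.
apply/and4P/eqP => [[Lx Ry /eqP iE /eqP jE]|[iE jE]].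
  have kk' : k' = k.
    by apply/eqP; case: okxy => /andP[? ?] ?; rewrite (kapP) // Lx.
  rewrite kk' -iE -jE; move: Li Rj; rewrite /inL /inR => ? ?.
  by congr pair; lia.
have [_ Lx Ry] := kap_ok okxy; rewrite -/k' in Lx Ry.
have kk' : k = k' by rewrite /k iE jE.
by rewrite kk' Lx Ry iE jE !addKn !eqxx.
Qed.

Lemma inI_id i j : pair_ok i j -> inI (iota 1 n) i j = false.
Proof.
move=> ok; have [kn Li Rj] := kap_ok ok; set k := kap i j in kn Li Rj.
have -> : iota 1 n = iota 1 k ++ iota k.+1 (n - k) by rewrite -add1n -iotaD subnKC //; lia.
have [I0 Ik _ _ _] := cut_tree_intervals ch_types kn.
apply: shuffled_none; first by move=> a; rewrite mem_iota /inR -/k; lia.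
by rewrite -/k count_interval //; move: Li; rewrite /inL; lia.
Qed.

Lemma inI_rev i j : pair_ok i j -> inI (rev (iota 1 n)) i j.
Proof.
move=> ok; have [kn Li Rj] := kap_ok ok; set k := kap i j in kn Li Rj.
have -> : iota 1 n = iota 1 k ++ iota k.+1 (n - k) by rewrite -add1n -iotaD subnKC //; lia.
have [_ _ kJ Jn _] := cut_tree_intervals ch_types kn.
rewrite rev_cat; apply: shuffled_all.
  by move=> a; rewrite mem_rev mem_iota /inL -/k; lia.
by rewrite -/k count_rev count_interval //; move: Rj; rewrite /inR; lia.
Qed.

Lemma descent (s : seq nat) : uniq s -> ~~ sorted ltn s ->
  exists A y x B, s = A ++ y :: x :: B /\ x < y.
Proof.
case: s => // a s; elim: s a => // b s IH a us /=; rewrite negb_and.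
case: (ltnP a b) => [ab /= ns|ba _].
  have [|A [y [x [B [-> xy]]]]] := IH b _ ns; first by case/andP: us.
  by exists (a :: A), y, x, B.
exists [::], a, b, s; split=> //; rewrite ltn_neqAle ba andbT.
by move: us; rewrite /= inE negb_or eq_sym => /andP[/andP[]].
Qed.

(** Every word other than the identity has a descent, and undoing it lowers the cardinality of
    [D s]. *)
Lemma word_ind (P : seq nat -> Prop) : P (iota 1 n) ->
    (forall (A B : seq nat) (x y : nat), valid (A ++ x :: y :: B) -> x < y ->
       P (A ++ x :: y :: B) -> P (A ++ y :: x :: B)) ->
  forall s, valid s -> P s.
Proof.
move=> P0 PS s; have [m] := ubnP #|D s|; elim: m s => // m IH s sm v.
case: (boolP (sorted ltn s)) => [ss|/(descent (valid_uniq v))[A [y [x [B [e xy]]]]]].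
  suff -> : s = iota 1 n by [].
  by apply: (irr_sorted_eq ltn_trans ltnn ss (iota_ltn_sorted 1 n)); apply: perm_mem.
have v' : valid (A ++ x :: y :: B) by apply: perm_valid v _; rewrite e; perm_tac.
rewrite e; apply: PS => //; apply: (IH _ _ v').
by have := card_step (D_step HD v' xy); rewrite -e; lia.
Qed.

(** A relation between indices and labels, shown below to be functional and injective; it matches
    index sets with the sets [D s] outside [D (iota 1 n)]. *)
Definition edge_label i j p := exists (A B : seq nat) (x y : nat),
  [/\ valid (A ++ x :: y :: B), x < y, (i, j) = edge_index A x y & lab A x y B = [set p]].

Lemma D_id s : valid s -> D (iota 1 n) \subset D s.
Proof.
apply: (@word_ind (fun s => D (iota 1 n) \subset D s)) => // A B x y v xy sub.
apply: subset_trans sub _.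
exact: step_sub (D_step HD v xy).
Qed.

Lemma edge_label_notin_id i j p : edge_label i j p -> p \notin D (iota 1 n).
Proof.
case=> A [B [x [y [v xy _ lp]]]]; apply/negP => /(subsetP (D_id v)) pD.
by have := set11 p; rewrite -lp inE pD.
Qed.

(** The index determines the cut, then both counts, so [lab_eq] applies. *)
Lemma edge_label_fun i j p p' : edge_label i j p -> edge_label i j p' -> p = p'.
Proof.
case=> A [B [x [y [v xy e lp]]]] [A' [B' [x' [y' [v' xy' e' lp']]]]].
have := edge_indexP v xy; rewrite -e => /= -[ok _ kE].
have := edge_indexP v' xy'; rewrite -e' => /= -[ok' _ kE'].
have [kn Lx Ry] := kap_ok ok; have [_ Lx' Ry'] := kap_ok ok'.
move: e e'; rewrite /edge_index -kE -kE' => -[e1 e2] [e1' e2'].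
rewrite -kE in kn Lx Ry; rewrite -kE' in Lx' Ry'.
have := lab_eq kn v v' Lx Ry Lx' Ry' _ _; rewrite lp lp' => E.
by apply/set1P; rewrite -E ?inE //; lia.
Qed.

(** Going up by one swap at a time, each new element of [D] is the label of a swap whose index
    enters [inI] at the same time. *)
Lemma D_edge_label s p : valid s -> p \in D s -> p \notin D (iota 1 n) ->
  exists i j, [/\ pair_ok i j, inI s i j & edge_label i j p].
Proof.
move=> v pD pn; move: s v pD; apply: word_ind => [|A B x y v xy IH].
  by rewrite (negPf pn).
rewrite (D_sub HD v xy) inE => /orP[/IH[i [j [ok si pl]]]|pl].
  by exists i, j; rewrite inI_edge ?si.
have [q lq] := step_setD (D_step HD v xy); have := edge_indexP v xy.
case e: (edge_index A x y) => [i j] /= [_ ok _]; exists i, j.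
rewrite inI_edge // e eqxx orbT; split=> //; exists A, B, x, y; split=> //.
by move: pl; rewrite [lab _ _ _ _]lq inE => /eqP->.
Qed.

Lemma inI_edge_label s i j : valid s -> pair_ok i j -> inI s i j ->
  exists2 p, p \in D s & edge_label i j p.
Proof.
move=> v ok; move: s v; apply: word_ind => [|A B x y v xy IH].
  by rewrite inI_id.
rewrite inI_edge // => /orP[/IH[p pD pl]|/eqP e].
  by exists p => //; apply: subsetP pD; apply: step_sub (D_step HD v xy).
have [q lq] := step_setD (D_step HD v xy); exists q; last by exists A, B, x, y.
have : q \in D (A ++ y :: x :: B) :\: D (A ++ x :: y :: B) by rewrite lq inE.
by rewrite inE => /andP[].
Qed.

(* All indices occur in the top word, so it is enough to compare along one chain. *)
Lemma edge_label_inj i j i' j' p : pair_ok i j -> pair_ok i' j' ->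
  edge_label i j p -> edge_label i' j' p -> (i, j) = (i', j').
Proof.
move=> ok ok' pl pl'.
suff H s : valid s -> inI s i j -> inI s i' j' -> (i, j) = (i', j').
  by apply: (H (rev (iota 1 n))); rewrite ?perm_rev ?inI_rev.
move: s; apply: word_ind => [|A B x y v xy IH]; first by rewrite inI_id.
rewrite (inI_edge v xy ok) (inI_edge v xy ok').
have new k l : pair_ok k l -> edge_label k l p -> (k, l) = edge_index A x y ->
    p \notin D (A ++ x :: y :: B).
  move=> okkl pkl e; have [q lq] := step_setD (D_step HD v xy).
  have qkl : edge_label k l q by exists A, B, x, y.
  rewrite (edge_label_fun pkl qkl); apply/negP => qD.
  by have := set11 q; rewrite -lq inE qD.
have old k l : pair_ok k l -> edge_label k l p -> inI (A ++ x :: y :: B) k l ->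
    p \in D (A ++ x :: y :: B).
  by move=> okkl pkl /(inI_edge_label v okkl)[q qD /(edge_label_fun pkl)->].
case/orP=> [h|/eqP h]; case/orP=> [h'|/eqP h'].
- exact: IH.
- by have := old _ _ ok pl h; rewrite (negPf (new _ _ ok' pl' h')).
- by have := old _ _ ok' pl' h'; rewrite (negPf (new _ _ ok pl h)).
- by rewrite h h'.
Qed.

(** The matching of indices with labels is the same for all words, so inclusions correspond. *)
Lemma D_sub_inI s s' : valid s -> valid s' ->
  (D s \subset D s') <-> (forall i j, pair_ok i j -> inI s i j -> inI s' i j).
Proof.
move=> v v'; split=> [/subsetP sub i j ok /(inI_edge_label v ok)[p /sub pD pl]|H].
  have [i' [j' [ok' I' pl']]] := D_edge_label v' pD (edge_label_notin_id pl).
  by case: (edge_label_inj ok ok' pl pl') => -> ->.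
apply/subsetP => p pD; case: (boolP (p \in D (iota 1 n))) => [/(subsetP (D_id v'))//|pn].
have [i [j [ok Is pl]]] := D_edge_label v pD pn.
have [q qD ql] := inI_edge_label v' ok (H _ _ ok Is).
by rewrite (edge_label_fun pl ql).
Qed.

Lemma tree_le_D (v w : 'S_n) : tree_le t v w = (D (word v) \subset D (word w)).
Proof.
apply/allP/idP => [H|/(D_sub_inI (perm_eq_word v) (perm_eq_word w)) H [i j]].
  apply/(D_sub_inI (perm_eq_word v) (perm_eq_word w)) => i j [ij jn] vij.
  by have := H (i, j); rewrite /= !mem_I ij jn vij => /(_ isT).
by rewrite /= !mem_I => /and3P[ij jn vij]; rewrite ij jn H.
Qed.

End Labels.

Theorem theorem4p13 (n : nat) (n_ge1 : 1 <= n) (le : rel 'S_n)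
    (le_distr : distributive_lattice le)
    (weak_le_le : forall v w : 'S_n, weak_le v w -> le v w)
    (le_bruhat_le : forall v w : 'S_n, le v w -> bruhat_le v w) :
  exists2 t : tree, t \in T_ n.-1 & forall v w : 'S_n, le v w = tree_le t v w.
Proof.
have [D [leE D_inj DU DI D_cov]] := word_sets le_distr weak_le_le le_bruhat_le.
have HD : compatible n D by [].
exists (cut_tree (triple_type n D) n 1 n); first exact: cut_tree_T.
by move=> v w; rewrite leE (tree_le_D HD).
Qed.
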